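(* Let $K$ be a simplicial complex. If $\dim(K)=d$, then $Sq^n=0$ in $H^*(\mathcal Z_K)$ for $n>\lfloor d/2\rfloor$. In particular, if $K$ is a graph ($d=1$), then there are no non-trivial Steenrod operations on $H^*(\mathcal Z_K)$.
   Context: $H^*(-)$ denotes cohomology with $\mathbb F_2$ coefficients and $Sq^n$ ($n\ge1$) are the mod 2 Steenrod squares; ''non-trivial Steenrod operation'' means some $Sq^n$ with $n\ge 1$ acting non-trivially. The dimension of a simplicial complex is the maximal dimension of its simplices. For a simplicial complex $K$ with vertex set $[m]=\{1,\dots,m\}$, the moment-angle complex is $\mathcal Z_K=(D^2,S^1)^K=\bigcup_{\sigma\in K}\prod_{i=1}^mY_i^\sigma\subseteq(D^2)^m$ with $Y_i^\sigma=D^2$ if $i\in\sigma$ and $Y_i^\sigma=S^1$ if $i\notin\sigma$. *)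

(* Defs.v *)
From HB Require Import structures.
From mathcomp Require Import all_boot all_order all_algebra.
From mathcomp Require Import all_classical all_reals.
From mathcomp Require Import topology normedtype.
From mathcomp Require Import zify.

Set Implicit Arguments.
Unset Strict Implicit.
Unset Printing Implicit Defensive.

Import Order.TTheory GRing.Theory Num.Theory.
Import numFieldNormedType.Exports.

Local Open Scope classical_set_scope.
Local Open Scope ring_scope.
Local Open Scope quotient_scope.

Definition std_simplex (R : realType) (n : nat) : set 'rV[R]_n.+1 :=
  [set t | (forall i, 0 <= t ord0 i) /\ \sum_i t ord0 i = 1].
Arguments std_simplex : clear implicits.

Section AffineMaps.
Variables (R : realType) (k n : nat) (f : 'I_k.+1 -> 'I_n.+1).

(* The restriction to Delta^k of the linear map sending the i-th vertex to the
   (f i)-th vertex. *)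
Definition pushforward (t : 'rV[R]_k.+1) : 'rV[R]_n.+1 :=
  \row_j \sum_(i | f i == j) t ord0 i.

Lemma pushforward_simplex (t : std_simplex R k) :
  pushforward (val t) \in std_simplex R n.
Proof.
case: t => t /= /set_mem[t0 t1]; apply/mem_set; split => [j|].
  by rewrite mxE; apply: sumr_ge0.
rewrite -t1 (partition_big f xpredT)//=.
by apply: eq_bigr => j _; rewrite mxE.
Qed.

Definition simplex_map (t : std_simplex R k) : std_simplex R n :=
  exist _ (pushforward (val t)) (pushforward_simplex t).

Lemma pushforward_continuous i j :
  continuous (fun t : std_simplex R k => pushforward (set_val t) i j).
Proof.
have -> : (fun t : std_simplex R k => pushforward (set_val t) i j) =
    (fun t => \sum_(a | f a == j) (set_val t : 'rV[R]_k.+1) ord0 a).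
  by apply/funext => t; rewrite mxE.
move=> t; have tF : Filter (nbhs t) := nbhs_filter t.
apply: cvg_big => [|a _]; first exact: add_continuous.
apply: (@continuous_comp _ _ _ (@set_val _ (std_simplex R k))
  (fun M : 'rV[R]_k.+1 => M ord0 a)).
  exact: initial_continuous.
exact: coord_continuous.
Qed.

Lemma simplex_map_continuous : continuous simplex_map.
Proof.
apply: (continuous_comp_initial (f := simplex_map)) => t A [P /= nP PA].
pose B (ij : 'I_1 * 'I_n.+1) (u : std_simplex R k) :=
  P ij.1 ij.2 (pushforward (set_val u) ij.1 ij.2).
have tF : Filter (nbhs t) := nbhs_filter t.
suff H : nbhs t (fun u => forall ij, B ij u).
  by apply: filterS H => u Bu; apply: PA => i j; exact: (Bu (i, j)).
apply: (filter_forall tF) => -[i j]; exact: pushforward_continuous (nP i j).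
Qed.

End AffineMaps.
Arguments simplex_map R {k n} f t.

Section Singular.
Variables (R : realType) (X : topologicalType).

Definition singular (n : nat) := continuousType (std_simplex R n) X.

Lemma restrict_continuous k n (s : singular n) (f : 'I_k.+1 -> 'I_n.+1) :
  continuous (s \o simplex_map R f).
Proof.
move=> t; apply: continuous_comp; first exact: simplex_map_continuous.
exact: cts_fun.
Qed.

Definition restrict k n (s : singular n) (f : 'I_k.+1 -> 'I_n.+1) : singular k :=
  mkcts (@restrict_continuous k n s f).

Definition cochain (n : nat) := singular n -> 'F_2.

Definition coboundary n (x : cochain n) : cochain n.+1 :=
  fun s => \sum_(i < n.+2) x (restrict s (lift i)).

(* The increasing enumeration of A, meaningful when #|A| = k + 1. *)
Definition vertices k n (A : {set 'I_n.+1}) : 'I_k.+1 -> 'I_n.+1 :=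
  fun i => nth ord0 (enum A) i.

Definition face_value k n (x : cochain k) (s : singular n) (A : {set 'I_n.+1})
  : 'F_2 :=
  if #|A| == k.+1 then x (restrict s (vertices A)) else 0.

(* A set J = {j_1 < ... < j_c} of cut vertices divides 0, ..., n into the blocks
   [0, j_1], [j_1, j_2], ..., [j_c, n], numbered from 0; consecutive blocks share
   a cut vertex, so every cut vertex lies in both unions below. *)
Definition before n (J : {set 'I_n}) (v : 'I_n) : nat :=
  #|[set j in J | (j < v)%N]%SET|.
Definition even_blocks n (J : {set 'I_n}) : {set 'I_n} :=
  [set v | (v \in J) || ~~ odd (before J v)]%SET.
Definition odd_blocks n (J : {set 'I_n}) : {set 'I_n} :=
  [set v | (v \in J) || odd (before J v)]%SET.

(* Steenrod's cup-i product with i = c - 1, as a sum over c cut vertices: x is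
   evaluated on the union of the even blocks and y on that of the odd ones.
   The two unions have (n + 1) + c vertices in total, so the product vanishes
   unless n + i = p + q. For c = 1 it is the Alexander-Whitney cup product. *)
Definition cup (c : nat) p q n (x : cochain p) (y : cochain q) : cochain n :=
  fun s => \sum_(J : {set 'I_n.+1} | #|J| == c)
             face_value x s (even_blocks J) * face_value y s (odd_blocks J).

End Singular.

Lemma F2_addxx (x : 'F_2) : x + x = 0.
Proof. by rewrite addrr_pchar2 ?pchar_Fp. Qed.

Lemma F2_opp (x : 'F_2) : - x = x.
Proof. by apply/esym/eqP; rewrite -addr_eq0 F2_addxx. Qed.

Section BlockCombinatorics.
Variable n : nat.
Implicit Types (J A : {set 'I_n.+1}) (u v : 'I_n.+1).

Lemma before_setU1 J v u :
  v \notin J -> before (v |: J) u = ((v < u)%N + before J u)%N.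
Proof.
move=> vJ; rewrite /before; case: ltnP => vu.
  rewrite (_ : [set j in v |: J | (j < u)%N]%SET =
               v |: [set j in J | (j < u)%N]%SET).
    by rewrite cardsU1 inE (negPf vJ).
  by apply/setP => j; rewrite !inE; case: eqVneq => [->|]; rewrite ?vu.
congr #|pred_of_set _|; apply/setP => j; rewrite !inE.
by case: eqVneq => [->|//]; rewrite (negPf vJ) ltnNge vu.
Qed.

Variables (f g : {set 'I_n.+1} -> 'F_2).

Let flipP J (t : nat) := [set u : 'I_n.+1 |
  (u \in J) || (odd (before J u) == (t <= u)%N)]%SET.
Let flipQ J (t : nat) := [set u : 'I_n.+1 |
  (u \in J) || (odd (before J u) != (t <= u)%N)]%SET.
Let D J t := f (flipP J t) * g (flipQ J t).

Lemma remove_cut J v : v \notin J ->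
  f (even_blocks (v |: J) :\ v) * g (odd_blocks (v |: J))
  + f (even_blocks (v |: J)) * g (odd_blocks (v |: J) :\ v) = D J v + D J v.+1.
Proof.
move=> vJ.
rewrite /D; have [r|/negPf r] := boolP (odd (before J v)).
  rewrite addrC; congr (f _ * g _ + f _ * g _); apply/setP => u;
    rewrite !inE ?before_setU1 // ?oddD -val_eqE /=;
    (case: (ltngtP u v) => [_|_|/val_inj->]; rewrite ?(negPf vJ) ?r //=);
    by case: (u \in J); case: (odd (before J u)).
congr (f _ * g _ + f _ * g _); apply/setP => u;
  rewrite !inE ?before_setU1 // ?oddD -val_eqE /=;
  (case: (ltngtP u v) => [_|_|/val_inj->]; rewrite ?(negPf vJ) ?r //=);
  by case: (u \in J); case: (odd (before J u)).
Qed.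

Lemma flip_telescope J :
  \sum_(v | v \notin J) (D J v + D J v.+1) =
  f (even_blocks J) * g (odd_blocks J) + f (odd_blocks J) * g (even_blocks J).
Proof.
transitivity (\sum_(v : 'I_n.+1) (D J v + D J v.+1)).
  rewrite [RHS](bigID (fun v => v \notin J)) /= [X in _ = _ + X]big1 ?addr0 //.
  move=> v /negPn vJ; rewrite /D (_ : flipP J v.+1 = flipP J v).
    rewrite (_ : flipQ J v.+1 = flipQ J v) ?F2_addxx //.
    apply/setP => u; rewrite !inE; have [->|] := eqVneq u v; first by rewrite vJ.
    by rewrite -val_eqE /=; case: ltngtP.
  apply/setP => u; rewrite !inE; have [->|] := eqVneq u v; first by rewrite vJ.
  by rewrite -val_eqE /=; case: ltngtP.
rewrite -(big_mkord xpredT (fun t => D J t + D J t.+1)).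
under eq_bigr => t _ do rewrite addrC -[X in _ + X]F2_opp.
rewrite telescope_sumr // F2_opp; congr (f _ * g _ + f _ * g _);
  apply/setP => u; rewrite !inE ?leq0n 1?leqNgt ?ltn_ord /=;
  by case: (u \in J); case: (odd _).
Qed.

Lemma split_by_cut J :
  (\sum_(v in even_blocks J) f (even_blocks J :\ v)) * g (odd_blocks J) +
  f (even_blocks J) * (\sum_(v in odd_blocks J) g (odd_blocks J :\ v)) =
  \sum_(v | v \notin J) f (even_blocks J :\ v) * g (odd_blocks J :\ v) +
  \sum_(v | v \in J) (f (even_blocks J :\ v) * g (odd_blocks J)
                     + f (even_blocks J) * g (odd_blocks J :\ v)).
Proof.
rewrite mulr_suml mulr_sumr.
rewrite [X in X + _ = _]big_mkcond [X in _ + X = _]big_mkcond -big_split /=.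
rewrite [X in _ = X + _]big_mkcond [X in _ = _ + X]big_mkcond -big_split /=.
apply: eq_bigr => v _; rewrite !inE.
have [vJ|vJ] := boolP (v \in J); first by rewrite /= add0r.
have setD1_id A : v \notin A -> A :\ v = A.
  move=> vA; apply/setP => u; rewrite !inE.
  by case: eqVneq => [->|//]; rewrite (negPf vA).
case: ifP => /= [r|/negbFE r]; rewrite ?(negPf r) ?r addr0 ?addr0 ?add0r.
  by rewrite (setD1_id (odd_blocks J)) // !inE (negPf vJ) (negPf r).
by rewrite (setD1_id (even_blocks J)) // !inE (negPf vJ) r.
Qed.

Lemma cup_boundary_formula c :
  \sum_(v : 'I_n.+1) \sum_(J : {set 'I_n.+1} | (#|J| == c.+1) && (v \notin J))
    f (even_blocks J :\ v) * g (odd_blocks J :\ v) =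
  \sum_(J : {set 'I_n.+1} | #|J| == c.+1)
    (\sum_(v in even_blocks J) f (even_blocks J :\ v)) * g (odd_blocks J) +
  \sum_(J : {set 'I_n.+1} | #|J| == c.+1)
    f (even_blocks J) * (\sum_(v in odd_blocks J) g (odd_blocks J :\ v)) +
  (\sum_(J : {set 'I_n.+1} | #|J| == c)
    f (even_blocks J) * g (odd_blocks J) +
   \sum_(J : {set 'I_n.+1} | #|J| == c)
    f (odd_blocks J) * g (even_blocks J)).
Proof.
rewrite -!big_split /=.
under [X in _ = X + _]eq_bigr do rewrite split_by_cut.
under [X in _ = _ + X]eq_bigr do rewrite -flip_telescope.
rewrite big_split /= -addrA [X in _ = X + _](exchange_big_dep xpredT) //=.
rewrite -[LHS]addr0; congr (_ + _).
apply/esym/eqP; rewrite addr_eq0 F2_opp; apply/eqP.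
rewrite (exchange_big_dep xpredT) //= [RHS](exchange_big_dep xpredT) //=.
apply: eq_bigr => v _.
rewrite (reindex_onto (fun J => v |: J) (fun J => J :\ v)) /=; last first.
  by move=> J /andP[_ vJ]; rewrite finset.setD1K.
apply: eq_big => [J|J /andP[/andP[/eqP Jc _] /eqP vJ]]; last first.
  by rewrite remove_cut // -vJ !inE eqxx.
have [vJ|vJ] := boolP (v \in J).
  rewrite andbF; apply/negP => /andP[_ /eqP] /setP/(_ v).
  by rewrite !inE eqxx vJ.
by rewrite cardsU1 vJ finset.setU1K // !inE !eqxx !andbT.
Qed.
End BlockCombinatorics.

Section Faces.
Variables (R : realType) (X : topologicalType).
Local Notation singular := (singular R X).
Local Notation cochain := (cochain R X).

Lemma restrict_comp a b n (s : singular n) (h : 'I_b.+1 -> 'I_n.+1)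
    (g : 'I_a.+1 -> 'I_b.+1) :
  restrict (restrict s h) g = restrict s (h \o g).
Proof.
apply/continuousEP => t /=; congr (s _); apply/val_inj/rowP => j /=.
rewrite !mxE (partition_big g (fun i => h i == j)) //=.
apply: eq_bigr => i /eqP hi; rewrite mxE; apply: eq_bigl => e.
by case: (eqVneq (g e) i) => [->|]; rewrite ?hi ?eqxx ?andbF.
Qed.

Lemma restrict_id n (s : singular n) : restrict s id = s.
Proof.
apply/continuousEP => t /=; congr (s _); apply/val_inj/rowP => j /=.
by rewrite mxE big_pred1_eq.
Qed.

Lemma sorted_enum_ord n (A : {set 'I_n}) :
  sorted (fun i j : 'I_n => (i < j)%N) (enum A).
Proof.
rewrite /enum_mem; apply: sorted_filter => [? ? ?|]; first exact: ltn_trans.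
have := iota_ltn_sorted 0 n; rewrite -val_enum_ord enumT.
by rewrite (@sorted_map _ _ val ltn).
Qed.

Lemma vertices_imset k a b (h : 'I_a.+1 -> 'I_b.+1) (A : {set 'I_a.+1}) :
  {homo h : i j / (i < j)%N} -> #|A| = k.+1 ->
  vertices (h @: A) = h \o vertices A :> ('I_k.+1 -> 'I_b.+1).
Proof.
move=> hh Ak; have E : enum (h @: A) = map h (enum A) :> seq 'I_b.+1.
  apply: (@irr_sorted_eq _ (fun i j : 'I_b.+1 => (i < j)%N)).
  - by move=> ? ? ?; exact: ltn_trans.
  - by move=> i /=; rewrite ltnn.
  - exact: sorted_enum_ord.
  - by rewrite sorted_map; apply: sub_sorted (sorted_enum_ord A) => i j /hh.
  - move=> j; rewrite mem_enum; apply/imsetP/mapP => -[i iA ->]; exists i => //.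
      by rewrite mem_enum.
    by rewrite -mem_enum.
by apply/funext => i /=; rewrite /vertices E (nth_map ord0) // -cardE Ak.
Qed.

Lemma homo_ord_inj a b (h : 'I_a -> 'I_b) :
  {homo h : i j / (i < j)%N} -> injective h.
Proof.
move=> hh i j hij; apply/val_inj; case: (ltngtP i j) => // /hh;
  by rewrite hij ltnn.
Qed.

Lemma face_value_restrict k a b (x : cochain k) (s : singular b)
    (h : 'I_a.+1 -> 'I_b.+1) (A : {set 'I_a.+1}) :
  {homo h : i j / (i < j)%N} ->
  face_value x (restrict s h) A = face_value x s (h @: A).
Proof.
move=> hh; rewrite /face_value card_imset; last exact: homo_ord_inj.
by case: eqP => // Ak; rewrite restrict_comp vertices_imset.
Qed.

Lemma vertices_homo k n (A : {set 'I_n.+1}) : #|A| = k.+1 ->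
  {homo (vertices A : 'I_k.+1 -> 'I_n.+1) : i j / (i < j)%N}.
Proof.
move=> Ak i j ij; rewrite /vertices.
apply: (sorted_ltn_nth (fun y x z : 'I_n.+1 => @ltn_trans y x z))
  (sorted_enum_ord A) _ _ _ _ ij; by rewrite inE -cardE Ak.
Qed.

Lemma vertices_setT n : vertices [set: 'I_n.+1] = id :> ('I_n.+1 -> 'I_n.+1).
Proof.
apply/funext => i; rewrite /vertices enum_setT; apply/val_inj.
by rewrite -enumT /= nth_enum_ord.
Qed.

Lemma face_value_setT n (x : cochain n) (s : singular n) :
  face_value x s [set: 'I_n.+1]%SET = x s.
Proof. by rewrite /face_value cardsT card_ord eqxx vertices_setT restrict_id. Qed.

Lemma vertices_image k n (A : {set 'I_n.+1}) : #|A| = k.+1 ->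
  (vertices A : 'I_k.+1 -> _) @: [set: 'I_k.+1]%SET = A.
Proof.
move=> Ak; apply/setP => v; apply/imsetP/idP => [[i _ ->]|vA].
  by rewrite -mem_enum mem_nth // -cardE Ak.
have vi : (index v (enum A) < k.+1)%N by rewrite -Ak cardE index_mem mem_enum.
by exists (Ordinal vi) => //; rewrite /vertices nth_index // mem_enum.
Qed.

Lemma lift_homo n (v : 'I_n.+1) : {homo lift v : i j / (i < j)%N}.
Proof. by move=> i j /=; rewrite /bump; lia. Qed.

Lemma lift_image n (v : 'I_n.+1) : lift v @: [set: 'I_n]%SET = [set~ v]%SET.
Proof.
apply/setP => u; rewrite !inE; apply/imsetP/idP => [[i _ ->]|].
  by rewrite eq_sym neq_lift.
by rewrite eq_sym => /unlift_some[i -> _]; exists i.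
Qed.

Lemma face_value_coboundary k n (x : cochain k) (s : singular n)
    (A : {set 'I_n.+1}) :
  face_value (coboundary x) s A = \sum_(v in A) face_value x s (A :\ v).
Proof.
rewrite {1}/face_value; case: eqP => [Ak|Ak]; last first.
  rewrite big1 // => v vA; rewrite /face_value; case: eqP => // Avk.
  by case: Ak; rewrite (cardsD1 v) vA Avk.
rewrite /coboundary -{2}(vertices_image Ak) big_imset /=; last first.
  by move=> i j _ _; exact/homo_ord_inj/vertices_homo.
apply: eq_big => [i|i _]; first by rewrite inE.
rewrite -face_value_setT face_value_restrict; last exact: lift_homo.
rewrite face_value_restrict; last exact: vertices_homo.
congr face_value; apply/setP => u; rewrite lift_image.
rewrite -{2}(vertices_image Ak) !inE.
apply/imsetP/andP => [[j ji ->]|[ui /imsetP[j _ uj]]].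
  split; last exact: imset_f.
  move: ji; rewrite !inE; apply: contra.
  by move=> /eqP/(homo_ord_inj (vertices_homo Ak))->.
by exists j => //; rewrite !inE; apply: contra ui => /eqP <-; rewrite uj.
Qed.

Lemma lift_blocks n (v : 'I_n.+1) (J : {set 'I_n}) :
  lift v @: even_blocks J = even_blocks (lift v @: J) :\ v /\
  lift v @: odd_blocks J = odd_blocks (lift v @: J) :\ v.
Proof.
have B u : before (lift v @: J) (lift v u) = before J u.
  rewrite /before -(card_imset _ (@lift_inj _ v)); congr #|pred_of_set _|.
  apply/setP => j; rewrite !inE; apply/andP/imsetP => [[/imsetP[i iJ ->]]|].
    move=> iu; exists i => //; rewrite !inE iJ /=.
    by move: iu; rewrite /= /bump; lia.
  case=> i; rewrite !inE => /andP[iJ iu] ->; rewrite imset_f //; split=> //.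
  exact: lift_homo.
have M (A : {set 'I_n}) (C : {set 'I_n.+1}) :
    (forall u, (u \in A) = (lift v u \in C)) -> lift v @: A = C :\ v.
  move=> AC; apply/setP => u; rewrite !inE.
  case: (unliftP v u) => [i ->|->].
    by rewrite mem_imset ?AC 1?eq_sym ?neq_lift //; exact: lift_inj.
  by rewrite eqxx; apply/imsetP => -[i _ /eqP]; rewrite (negPf (neq_lift _ _)).
by split; apply: M => u; rewrite !inE B mem_imset //; exact: lift_inj.
Qed.

Lemma coboundary_cup c p q n (x : cochain p) (y : cochain q) :
  coboundary (cup c.+1 x y : cochain n) =
  cup c.+1 (coboundary x) y + cup c.+1 x (coboundary y)
  + (cup c x y + cup c y x).
Proof.
apply/funext => s; rewrite /coboundary /cup /=.
have := cup_boundary_formula (face_value x s) (face_value y s) c.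
rewrite !fctE.
under [X in _ = X + _ + _ -> _]eq_bigr do rewrite -face_value_coboundary.
under [X in _ = _ + X + _ -> _]eq_bigr do rewrite -face_value_coboundary.
under [X in _ = _ + (_ + X) -> _]eq_bigr do rewrite mulrC.
move=> <-; apply: eq_bigr => v _.
rewrite [RHS](reindex_onto (fun J : {set 'I_n.+1} => lift v @: J)
    (fun J : {set 'I_n.+2} => lift v @^-1: J)).
  apply: eq_big => [J|J Jc].
    rewrite card_imset; last exact: lift_inj.
    have -> : v \notin lift v @: J.
      by apply/imsetP => -[i _ /eqP]; rewrite (negPf (neq_lift _ _)).
    suff -> : lift v @^-1: (lift v @: J) = J by rewrite eqxx !andbT.
    by apply/setP => i; rewrite inE mem_imset //; exact: lift_inj.
  have [E O] := lift_blocks v J.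
  by rewrite !face_value_restrict ?E ?O //; exact: lift_homo.
move=> J /andP[_ vJ]; apply/setP => u; apply/imsetP/idP => [[i]|uJ].
  by rewrite inE => iJ ->.
case: (unliftP v u) => [i ui|uv]; first by exists i; rewrite // inE -ui.
by move: vJ; rewrite -uv uJ.
Qed.

Lemma cup0 p q n (x : cochain p) (y : cochain q) : cup 0 x y = 0 :> cochain n.
Proof.
apply/funext => s; rewrite /cup big1 // => J; rewrite cards_eq0 => /eqP ->.
suff -> : odd_blocks finset.set0 = finset.set0 :> {set 'I_n.+1}.
  by rewrite [face_value y _ _]/face_value cards0 mulr0.
apply/setP => v; rewrite !inE /before.
rewrite (_ : finset _ = finset.set0) ?cards0 //.
by apply/setP => j; rewrite !inE.
Qed.

Lemma face_valueD k n (x y : cochain k) (s : singular n) A :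
  face_value (x + y) s A = face_value x s A + face_value y s A.
Proof. by rewrite /face_value; case: ifP; rewrite ?addr0. Qed.

Lemma cupDl c p q n (x x' : cochain p) (y : cochain q) :
  cup c (x + x') y = cup c x y + cup c x' y :> cochain n.
Proof.
apply/funext => s; rewrite -[RHS]/(_ s + _ s) /cup -big_split /=.
by apply: eq_bigr => J _; rewrite face_valueD mulrDl.
Qed.

Lemma cupDr c p q n (x : cochain p) (y y' : cochain q) :
  cup c x (y + y') = cup c x y + cup c x y' :> cochain n.
Proof.
apply/funext => s; rewrite -[RHS]/(_ s + _ s) /cup -big_split /=.
by apply: eq_bigr => J _; rewrite face_valueD mulrDr.
Qed.

Lemma coboundaryD k (x y : cochain k) :
  coboundary (x + y) = coboundary x + coboundary y.
Proof. by apply/funext => s; rewrite -[RHS]/(_ s + _ s) -big_split. Qed.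

Lemma cochain_addxx k (x : cochain k) : x + x = 0.
Proof. by apply/funext => s; exact: F2_addxx. Qed.

Lemma cochain_opp k (x : cochain k) : - x = x.
Proof. by apply/eqP; rewrite eq_sym -addr_eq0 cochain_addxx. Qed.

Lemma face_value0 k n (s : singular n) A : face_value (0 : cochain k) s A = 0.
Proof. by rewrite /face_value; case: ifP. Qed.

Lemma cup0l c p q n (y : cochain q) : cup c (0 : cochain p) y = 0 :> cochain n.
Proof.
by apply/funext => s; rewrite /cup big1 // => J _; rewrite face_value0 mul0r.
Qed.

Lemma cup0r c p q n (x : cochain p) : cup c x (0 : cochain q) = 0 :> cochain n.
Proof.
by apply/funext => s; rewrite /cup big1 // => J _; rewrite face_value0 mulr0.
Qed.

End Faces.

Section Cohomology.
Variables (R : realType) (X : topologicalType).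
Local Notation cochain := (cochain R X).

Definition is_cocycle k : {pred cochain k} := fun x => coboundary x == 0.

Definition is_coboundary k : {pred cochain k} :=
  match k with
  | 0 => fun x => x == 0
  | j.+1 => fun x => `[< exists y : cochain j, x = coboundary y >]
  end.

Lemma coboundary0 k : coboundary (0 : cochain k) = 0.
Proof. by apply/funext => s; rewrite /coboundary big1. Qed.

Lemma is_coboundary0 k : 0 \in @is_coboundary k.
Proof.
case: k => [|k]; first exact/eqP.
by apply/asboolP; exists 0; rewrite coboundary0.
Qed.

Lemma is_cocycle_zmod_closed k : zmod_closed (@is_cocycle k).
Proof.
split=> [|x y /eqP x0 /eqP y0]; first by apply/eqP; exact: coboundary0.
by apply/eqP; rewrite coboundaryD cochain_opp x0 y0 addr0.
Qed.
HB.instance Definition _ k :=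
  GRing.isZmodClosed.Build (cochain k) (@is_cocycle k) (@is_cocycle_zmod_closed k).

Record cocycle k := Cocycle {
  cocycle_val :> cochain k; cocycleP : cocycle_val \in @is_cocycle k }.
HB.instance Definition _ k := [isSub of cocycle k for @cocycle_val k].
HB.instance Definition _ k := [Choice of cocycle k by <:].
HB.instance Definition _ k := [SubChoice_isSubZmodule of cocycle k by <:].

Definition null_cocycle k : {pred cocycle k} :=
  fun z => val z \in @is_coboundary k.

Lemma null_cocycle_zmod_closed k : zmod_closed (@null_cocycle k).
Proof.
case: k => [|k]; split=> [|z w].
- by rewrite !unfold_in eqxx.
- by rewrite !unfold_in => /eqP z0 /eqP w0; rewrite raddfB /= z0 w0 subr0.
- by apply/asboolP; exists 0; rewrite coboundary0.
move=> /asboolP[x zx] /asboolP[y wy]; apply/asboolP; exists (x + y).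
by rewrite coboundaryD -zx -wy /= cochain_opp.
Qed.
HB.instance Definition _ k := GRing.isZmodClosed.Build (cocycle k)
  (@null_cocycle k) (@null_cocycle_zmod_closed k).

Definition cohomology k := Quotient.quot (@null_cocycle k).
HB.instance Definition _ k := ZmodQuotient.on (cohomology k).

(* Steenrod's definition: Sq^n x = x cup_(k-n) x in degree k, and 0 if n > k. *)
Definition sq_cochain n k (x : cochain k) : cochain (k + n) :=
  if (n <= k)%N then cup (k - n).+1 x x else 0.
Arguments sq_cochain n {k} x.

Lemma sq_cochain_cocycle n k (z : cocycle k) :
  sq_cochain n z \in @is_cocycle (k + n).
Proof.
case: z => x /= /eqP dx; rewrite /sq_cochain; case: ifP => _; apply/eqP.
  by rewrite coboundary_cup dx cup0l cup0r add0r add0r cochain_addxx.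
exact: coboundary0.
Qed.

Definition sq_cocycle n k (z : cocycle k) : cocycle (k + n) :=
  Cocycle (sq_cochain_cocycle n z).

Definition Sq n k (a : cohomology k) : cohomology (k + n) :=
  \pi_(cohomology (k + n)) (sq_cocycle n (repr a)).
Arguments Sq n {k} a.

Lemma cup_comm_null n k (z w : cocycle k) : (n <= k)%N ->
  cup (k - n).+1 z w + cup (k - n).+1 w z \in @is_coboundary (k + n).
Proof.
case: z w => [x /= /eqP dx] [y /= /eqP dy] nk.
case: k x y nk dx dy => [|k] x y nk dx dy.
  case: n nk => // _; rewrite unfold_in; apply/eqP/funext => s.
  rewrite -[LHS]/(_ s + _ s) -big_split big1 //= => J J1.
  have ->: J = [set: 'I_1]%SET.
    by apply/eqP; rewrite eqEcard finset.subsetT cardsT card_ord (eqP J1).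
  have -> : even_blocks ([set: 'I_1]%SET) = odd_blocks ([set: 'I_1]%SET).
    by apply/setP => v; rewrite !inE.
  by rewrite mulrC F2_addxx.
apply/asboolP; exists (cup (k.+1 - n).+2 x y).
by rewrite coboundary_cup dx dy cup0l cup0r !add0r.
Qed.

Lemma sq_cochain_null n k (z : cocycle k) :
  z \in @null_cocycle k -> sq_cochain n z \in @is_coboundary (k + n).
Proof.
rewrite /sq_cochain; case: z => x dx; rewrite unfold_in /=.
case: ifP => [nk|_ _]; last exact: is_coboundary0.
case: k x dx nk => [|k] x dx nk.
  by move=> /eqP ->; rewrite cup0l; case: n nk => // _; apply/eqP.
move=> /asboolP[y xy]; apply/asboolP.
exists (cup (k.+1 - n).+1 y x + cup (k.+1 - n) y y).
move/eqP : dx => dx.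
rewrite coboundaryD coboundary_cup dx cup0r addr0 -xy.
case: (k.+1 - n)%N => [|c]; first by rewrite !cup0 coboundary0 !addr0.
rewrite coboundary_cup -xy [cup c y y + _]cochain_addxx addr0.
by rewrite [X in _ + X + _]addrC -addrA cochain_addxx addr0.
Qed.

Lemma is_coboundaryD k (x y : cochain k) :
  x \in @is_coboundary k -> y \in @is_coboundary k -> x + y \in @is_coboundary k.
Proof.
case: k x y => [|k] x y; first by move=> /eqP -> /eqP ->; apply/eqP; exact: addr0.
move=> /asboolP[u ->] /asboolP[v ->]; apply/asboolP.
by exists (u + v); rewrite coboundaryD.
Qed.

Lemma sq_cochainD n k (z w : cocycle k) :
  sq_cochain n (z + w : cocycle k) - (sq_cochain n z + sq_cochain n w)
    \in @is_coboundary (k + n).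
Proof.
rewrite cochain_opp /sq_cochain; case: ifP => nk.
  rewrite (_ : cup _ _ _ + _ = cup (k - n).+1 z w + cup (k - n).+1 w z).
    exact: cup_comm_null.
  rewrite /= cupDl !cupDr.
  set a := cup _ _ _; set b := cup _ _ _; set c := cup _ _ _; set d := cup _ _ _.
  by rewrite [c + d]addrC (addrACA a b d c) (addrAC (a + d)) cochain_addxx add0r.
by rewrite !addr0; exact: is_coboundary0.
Qed.

Lemma sq_cocycle_pi n k (z w : cocycle k) :
  z = w %[mod cohomology k] ->
  sq_cocycle n z = sq_cocycle n w %[mod cohomology (k + n)].
Proof.
move=> /eqP; rewrite -Quotient.idealrBE => zw; apply/eqP.
rewrite -Quotient.idealrBE unfold_in.
have -> : val (sq_cocycle n z - sq_cocycle n w) =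
    sq_cochain n (z - w) + (sq_cochain n z - (sq_cochain n (z - w) + sq_cochain n w)).
  rewrite !cochain_opp raddfB /= cochain_opp addrCA.
  by rewrite [_ + (_ + _)]addrCA addrA addrACA cochain_addxx add0r addrC.
apply: is_coboundaryD; first exact: sq_cochain_null.
by have := sq_cochainD n (z - w) w; rewrite subrK.
Qed.

Lemma SqE n k (z : cocycle k) :
  Sq n (\pi_(cohomology k) z) = \pi_(cohomology (k + n)) (sq_cocycle n z).
Proof. by apply: sq_cocycle_pi; rewrite reprK. Qed.

Lemma Sq_additive n k : zmod_morphism (@Sq n k).
Proof.
suff SqD a b : Sq n (a + b) = Sq n a + Sq n b :> cohomology (k + n).
  by move=> a b; have := SqD (a - b) b; rewrite subrK => ->; rewrite addrK.
rewrite -[a]reprK -[b]reprK; set z := repr a; set w := repr b.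
rewrite -(raddfD (\pi_(cohomology k))) !SqE -(raddfD (\pi_(cohomology (k + n)))).
apply/eqP; rewrite -Quotient.idealrBE; exact: sq_cochainD.
Qed.
HB.instance Definition _ n k :=
  GRing.isZmodMorphism.Build (cohomology k) (cohomology (k + n)) (@Sq n k)
    (@Sq_additive n k).

End Cohomology.

Record simplicial_complex (m : nat) := SimplicialComplex {
  faces : {set {set 'I_m}};
  faces0 : finset.set0 \in faces;
  faces_sub : forall s t : {set 'I_m}, t \subset s -> s \in faces -> t \in faces }.

(* Integer-valued: the complex whose only simplex is the empty one has
   dimension -1. *)
Definition complex_dim m (K : simplicial_complex m) : int :=
  (\max_(s in faces K) #|s|)%:Z - 1.

Section MomentAngle.
Variable R : realType.

Definition disc : set 'rV[R]_2 := [set z | \sum_j z ord0 j ^+ 2 <= 1].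
Definition circle : set 'rV[R]_2 := [set z | \sum_j z ord0 j ^+ 2 = 1].

(* A point of (R^2)^m is an m x 2 matrix, its i-th coordinate being row i. *)
Definition moment_angle_set m (K : simplicial_complex m) : set 'M[R]_(m, 2) :=
  \bigcup_(s in [set` faces K])
    [set z | forall i, (if i \in s then disc else circle) (row i z)].

Definition moment_angle m (K : simplicial_complex m) : topologicalType :=
  set_type (moment_angle_set K).

End MomentAngle.

(* Main.v *)
Require Import Defs.
From mathcomp Require Import all_boot all_order all_algebra.
From mathcomp Require Import all_classical all_reals.
From mathcomp Require Import topology normedtype sequences realfun.
From mathcomp Require Import zify ring lra.
Require Import Defs.

(* Work with singular simplices of the whole space (R^2)^m, and with families of
   them cut out by conditions on their images.  By barycentric subdivision and a
   homotopy flattening the coordinate axes of each disc, a cocycle on Z_K is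
   determined by the simplices each of whose coordinates lies in one of three
   sectors of the disc (right half, upper left, lower left quadrant) and which
   lie in a single block of Z_K.

   Process the coordinates one by one.  Pulling back along the projection of the
   i-th coordinate to the base point 1 splits a class into a part that does not
   depend on that coordinate and a part that is reduced in it.  The right half
   disc contracts to 1, and each left quadrant contracts to its vertical edge,
   so the reduced part is a Mayer-Vietoris suspension of a class of one degree
   less in which the i-th coordinate runs over the segment [-1, 0], relative to
   0; the connecting map commutes with Sq^n.

   When every coordinate is processed there remain a class y of degree k on a
   union of cubes [-1, 0]^s, s in K, relative to the points with a zero
   coordinate.  If n > k then Sq^n y = 0 by definition.  If n = k then Sq^n y is
   the square of y, which vanishes since the union of cubes is contractible.  If
   n < k then Sq^n y has degree k + n > 2n >= d + 1, and the relative cohomology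
   vanishes above the dimension d + 1 of the cubes. *)

Set Implicit Arguments.
Unset Strict Implicit.
Unset Printing Implicit Defensive.

Import Order.TTheory GRing.Theory Num.Theory.
Import numFieldNormedType.Exports.
Local Open Scope classical_set_scope.
Local Open Scope ring_scope.

Arguments sq_cochain {R X} n {k} x.

(** * Chains of finite lists of points, mod 2 *)

Lemma F2P (x : 'F_2) : x = 0 \/ x = 1.
Proof. by case: x => -[|[|//]] p; [left|right]; apply/val_inj. Qed.

Ltac f2 :=
  intros; repeat match goal with
  | x : _ |- _ => case: (F2P x) => ?; subst x end;
  first [by apply/eqP | match goal with H : _ |- _ => by move/eqP: H end].

Section ListOperators.
Variable E : Type.
Implicit Types (phi psi : seq E -> 'F_2) (p q : seq E) (v : E).

(** The mod 2 simplicial coboundary on functions of vertex lists. Recursion on the head turns the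
    chain identities below into short inductions; the indexed sum is recovered in [dbound_sum]. *)
Fixpoint dbound phi p : 'F_2 :=
  if p is v :: p' then phi p' + dbound (fun q => phi (v :: q)) p' else 0.

Lemma eq_dbound phi psi p :
  (forall q, (size q).+1 = size p -> phi q = psi q) ->
  dbound phi p = dbound psi p.
Proof.
elim: p phi psi => //= v p IH phi psi e; rewrite e //.
by congr (_ + _); apply: IH => q qp; apply: e; rewrite /= qp.
Qed.

Lemma dboundD phi psi p :
  dbound (fun q => phi q + psi q) p = dbound phi p + dbound psi p.
Proof.
elim: p phi psi => [|v p IH] phi psi /=; first by rewrite addr0.
by rewrite IH addrACA.
Qed.

Lemma dbound_dbound phi p : dbound (dbound phi) p = 0.
Proof.
elim: p phi => //= v p IH phi.
by rewrite (dboundD phi) IH addr0 F2_addxx.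
Qed.

Lemma dbound_sum phi p :
  dbound phi p = \sum_(i < size p) phi (take i p ++ drop i.+1 p).
Proof.
elim: p phi => [|v p IH] phi /=; first by rewrite big_ord0.
rewrite big_ord_recl /= IH. by rewrite drop0.
Qed.

Lemma nth_remove v p i j : (i < size p)%N ->
  nth v (take i p ++ drop i.+1 p) j = nth v p (bump i j).
Proof.
move=> ip; rewrite nth_cat size_take ip /bump.
case: ltnP => ij; first by rewrite nth_take // add0n.
by rewrite nth_drop; congr nth; lia.
Qed.

Lemma size_remove p i : (i < size p)%N ->
  size (take i p ++ drop i.+1 p) = (size p).-1.
Proof. by move=> ip; rewrite size_cat size_take size_drop ip; lia. Qed.

End ListOperators.

Lemma dbound_map (E E' : Type) (g : E -> E') (phi : seq E' -> 'F_2) p :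
  dbound (fun q => phi (map g q)) p = dbound phi (map g p).
Proof. by elim: p phi => //= v p IH phi; rewrite -IH. Qed.

(** * The prism operator on lists *)

Section Prism.
Variable E : Type.
Implicit Types (phi : seq (E * bool) -> 'F_2) (p : seq E).

Definition level (b : bool) (v : E) := (v, b).

(** The standard triangulation of the prism: each simplex runs along the bottom up to some vertex,
    climbs there, and continues along the top. *)
Fixpoint prism phi p : 'F_2 :=
  if p is v :: p' then
    phi [:: (v, false), (v, true) & map (level true) p']
    + prism (fun q => phi ((v, false) :: q)) p'
  else 0.

Lemma eq_prism phi psi p :
  (forall q, phi q = psi q) -> prism phi p = prism psi p.
Proof. by move=> e; congr prism; apply/funext. Qed.

Lemma prismD phi psi p :
  prism (fun q => phi q + psi q) p = prism phi p + prism psi p.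
Proof.
elim: p phi psi => [|v p IH] phi psi /=; first by rewrite addr0.
by rewrite IH addrACA.
Qed.

Lemma prism_formula phi p :
  prism (dbound phi) p + dbound (prism phi) p =
  phi (map (level true) p) + phi (map (level false) p).
Proof.
elim: p phi => [|v p IH] phi /=; first by rewrite addr0 F2_addxx.
rewrite (prismD phi) (dboundD
  (fun q => phi [:: (v, false), (v, true) & map (level true) q])).
rewrite (dbound_map _ (fun q => phi [:: (v, false), (v, true) & q])).
have aux (a b x y z d e : 'F_2) : a + b = x + y ->
    z + (x + d) + (e + a) + (e + (d + b)) = z + y.
  by f2.
by apply: aux; exact: IH.
Qed.

End Prism.

(** * Formal subdivision of lists and its chain homotopy *)

Section Subdivision.
Variables (E : Type) (bar : seq E -> E).
Implicit Types (phi : seq E -> 'F_2) (p q : seq E).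

(** The facets of [p] are subdivided and coned off from [bar p]. The recursion is not structural in
    [p], so it is driven by a counter [n], set to the length of [p]. *)
Fixpoint subdiv_rec n phi p : 'F_2 :=
  if n is n'.+1 then
    dbound (subdiv_rec n' (fun q => phi (bar p :: q))) p
  else phi p.
Definition subdiv phi p := subdiv_rec (size p) phi p.

(** The chain homotopy T with T(p) = b(p + T(dp)), where b cones from [bar p] and d is the boundary;
    it joins subdivision to the identity. *)
Fixpoint cone_rec n phi p : 'F_2 :=
  if n is n'.+1 then
    phi (bar p :: p) + dbound (cone_rec n' (fun q => phi (bar p :: q))) p
  else 0.
Definition cone phi p := cone_rec (size p) phi p.

Lemma subdivE phi p : (0 < size p)%N ->
  subdiv phi p = dbound (subdiv (fun q => phi (bar p :: q))) p.
Proof.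
rewrite /subdiv; case sp: (size p) => [//|n] _ /=.
by apply: eq_dbound => q; rewrite sp => -[->].
Qed.

Lemma coneE phi p : (0 < size p)%N ->
  cone phi p =
  phi (bar p :: p) + dbound (cone (fun q => phi (bar p :: q))) p.
Proof.
rewrite /cone; case sp: (size p) => [//|n] _ /=.
by congr (_ + _); apply: eq_dbound => q; rewrite sp => -[->].
Qed.

Lemma coneD phi psi p :
  cone (fun q => phi q + psi q) p = cone phi p + cone psi p.
Proof.
have [n np] := ubnP (size p); elim: n => // n IH in phi psi p np *.
have [p0|p0] := posnP (size p); first by rewrite /cone p0 addr0.
rewrite !coneE // (eq_dbound (psi := fun q =>
  cone (fun q => phi (bar p :: q)) q + cone (fun q => psi (bar p :: q)) q)).
  by rewrite dboundD addrACA.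
by move=> q qp; rewrite IH //; lia.
Qed.

(** Induction on the length. At [bar p :: q], [dbound phi] splits into [phi q] and the boundary of
    the coned function; the induction hypothesis treats the latter, and [dbound_dbound] removes the
    double boundary. *)
Lemma cone_formula phi p :
  cone (dbound phi) p + dbound (cone phi) p = phi p + subdiv phi p.
Proof.
have [n np] := ubnP (size p); elim: n => // n IH in phi p np *.
have [p0|p0] := posnP (size p).
  by case: p p0 {np} => // _; rewrite /cone /subdiv /= addr0 F2_addxx.
rewrite coneE // subdivE //=; set b := bar p.
have -> : dbound (cone (fun q => dbound phi (b :: q))) p =
    dbound (fun q => cone phi q
    + (dbound (cone (fun q => phi (b :: q))) q
       + (phi (b :: q) + subdiv (fun q => phi (b :: q)) q))) p.
  apply: eq_dbound => q qp; transitivity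
    (cone phi q + cone (dbound (fun r => phi (b :: r))) q).
    exact: (coneD phi (dbound (fun r => phi (b :: r))) q).
  rewrite -IH; last lia.
  by congr (_ + _); move: (cone _ _) (dbound _ _); f2.
rewrite 3!dboundD dbound_dbound.
by move: (dbound _ _) (dbound _ _) (dbound _ _) (phi p); f2.
Qed.

Lemma cone_eq0 phi p : (forall q, phi q = 0) -> cone phi p = 0.
Proof.
move=> phi0; have [n np] := ubnP (size p); elim: n => // n IH in phi phi0 p np *.
have [p0|p0] := posnP (size p); first by rewrite /cone p0.
rewrite coneE // phi0 add0r (eq_dbound (psi := fun=> 0)).
  by rewrite dbound_sum big1.
by move=> q qp; apply: IH => //; lia.
Qed.

End Subdivision.

Section SubdivisionMap.
Variables (E E' : Type) (bar : seq E -> E) (bar' : seq E' -> E') (g : E -> E').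
Hypothesis barE : forall p, (0 < size p)%N -> bar' (map g p) = g (bar p).

Lemma subdiv_map phi p :
  subdiv bar (fun q => phi (map g q)) p = subdiv bar' phi (map g p).
Proof.
have [n np] := ubnP (size p); elim: n => // n IH in phi p np *.
have [p0|p0] := posnP (size p); first by rewrite /subdiv size_map p0.
rewrite !subdivE ?size_map // barE // -dbound_map.
apply: eq_dbound => q qp.
by rewrite (IH (fun q => phi (g (bar p) :: q))) //; lia.
Qed.

Lemma cone_map phi p :
  cone bar (fun q => phi (map g q)) p = cone bar' phi (map g p).
Proof.
have [n np] := ubnP (size p); elim: n => // n IH in phi p np *.
have [p0|p0] := posnP (size p); first by rewrite /cone size_map p0.
rewrite !coneE ?size_map // barE // -dbound_map; congr (_ + _).
apply: eq_dbound => q qp.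
by rewrite (IH (fun q => phi (g (bar p) :: q))) //; lia.
Qed.

End SubdivisionMap.

(** * Prisms *)

Section Evaluation.
Variables (R : realType) (Y : topologicalType) (E : Type) (e0 : E).
Variable real : forall k, ('I_k.+1 -> E) -> singular R Y k.
Hypothesis realE : forall j k (f : 'I_j.+1 -> 'I_k.+1) (p : 'I_k.+1 -> E),
  restrict (real p) f = real (p \o f).

(** The value 0 off the right length makes a cochain a function on lists of any length, to which the
    list identities apply. *)
Definition ev k (x : cochain R Y k) (p : seq E) : 'F_2 :=
  if size p == k.+1 then x (real (fun j : 'I_k.+1 => nth e0 p j)) else 0.

Lemma ev_coboundary k (x : cochain R Y k) p :
  ev (coboundary x) p = dbound (ev x) p.
Proof.
rewrite dbound_sum {1}/ev; case: eqP => [sp|sp].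
  rewrite sp; apply: eq_bigr => i _; rewrite /ev size_remove ?sp ?ltn_ord //=.
  rewrite eqxx realE; congr (x (real _)); apply/funext => j /=.
  by rewrite nth_remove ?sp.
rewrite big1 // => i _; rewrite /ev size_remove //; case: eqP => // sp'.
by case: sp; rewrite -sp' prednK //; case: i => i /=; case: (size p).
Qed.

End Evaluation.

Lemma simplex_map_comp (R : realType) a b n (h : 'I_b.+1 -> 'I_n.+1)
    (g : 'I_a.+1 -> 'I_b.+1) (t : std_simplex R a) :
  simplex_map R h (simplex_map R g t) = simplex_map R (h \o g) t.
Proof.
apply/val_inj/rowP => j /=; rewrite !mxE.
rewrite (partition_big g (fun i => h i == j)) //=.
apply: eq_bigr => i /eqP hi; rewrite mxE; apply: eq_bigl => e.
by case: (eqVneq (g e) i) => [->|]; rewrite ?hi ?eqxx ?andbF.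
Qed.

Lemma simplex_map_id (R : realType) n (t : std_simplex R n) :
  simplex_map R id t = t.
Proof. by apply/val_inj/rowP => j /=; rewrite mxE big_pred1_eq. Qed.

Lemma continuous_pair (S T U : topologicalType) (f : S -> T) (g : S -> U) :
  continuous f -> continuous g -> continuous (fun x => (f x, g x)).
Proof. by move=> fc gc x; apply: cvg_pair; [exact: fc | exact: gc]. Qed.

Section Homotopy.
Variables (R : realType) (Y : topologicalType) (H : R * Y -> Y).
Hypothesis Hc : continuous H.

(** The time coordinate on a simplex of the prism whose vertices lie at the levels [b]. Written
    through a map to the 1-simplex, it inherits continuity and naturality from the maps of
    simplices. *)
Definition clock k (b : 'I_k.+1 -> bool) (w : std_simplex R k) : R :=
  pushforward (fun j => if b j then ord_max else ord0 : 'I_2) (set_val w)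
    ord0 ord_max.

Lemma clock_continuous k (b : 'I_k.+1 -> bool) : continuous (clock b).
Proof. exact: pushforward_continuous. Qed.

Lemma clock_comp j k (f : 'I_j.+1 -> 'I_k.+1) b (w : std_simplex R j) :
  clock b (simplex_map R f w) = clock (b \o f) w.
Proof.
pose h b : 'I_2 := if b then ord_max else ord0.
have /(congr1 (fun t : std_simplex R 1 => val t ord0 ord_max)) :=
  simplex_map_comp (h \o b) f w.
by [].
Qed.

Lemma clock_itv k b (w : std_simplex R k) : 0 <= clock b w <= 1.
Proof.
case: w => w /= wP; have [w0 w1] := set_mem wP; rewrite /clock mxE /=.
rewrite sumr_ge0 //= -w1 [leRHS](bigID
  (fun i => (if b i then ord_max else ord0 : 'I_2) == ord_max)) /=.
by rewrite lerDl sumr_ge0.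
Qed.

Lemma clock_true k (w : std_simplex R k) : clock (fun=> true) w = 1.
Proof.
by case: w => w /= wP; have [_ <-] := set_mem wP; rewrite /clock mxE /=.
Qed.

Lemma clock_false k (w : std_simplex R k) : clock (fun=> false) w = 0.
Proof. by rewrite /clock mxE big1. Qed.

Section Cut.
Variables (n : nat) (s : singular R Y n).

Lemma cut_continuous k (p : 'I_k.+1 -> 'I_n.+1 * bool) :
  continuous (fun w : std_simplex R k =>
    H (clock (snd \o p) w, s (simplex_map R (fst \o p) w))).
Proof.
move=> w; apply: continuous_comp; last exact: Hc.
apply: (@continuous_pair _ R Y); first exact: clock_continuous.
by move=> v; apply: continuous_comp; [exact: simplex_map_continuous | exact: cts_fun].
Qed.

Definition cut k (p : 'I_k.+1 -> 'I_n.+1 * bool) : singular R Y k :=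
  mkcts (@cut_continuous k p).

Lemma restrict_cut j k (f : 'I_j.+1 -> 'I_k.+1) p :
  restrict (cut p) f = cut (p \o f).
Proof.
apply/continuousEP => w.
rewrite -[LHS]/(H (clock (snd \o p) (simplex_map R f w),
  s (simplex_map R (fst \o p) (simplex_map R f w)))).
by rewrite clock_comp simplex_map_comp.
Qed.

End Cut.

Lemma slice_continuous n (s : singular R Y n) (t : R) :
  continuous (fun w => H (t, s w)).
Proof.
move=> w; apply: continuous_comp; last exact: Hc.
by apply: (@continuous_pair _ R Y); [exact: cst_continuous | exact: cts_fun].
Qed.

Definition slice (t : R) n (s : singular R Y n) : singular R Y n :=
  mkcts (@slice_continuous n s t).

Definition prism_cochain k (x : cochain R Y k.+1) : cochain R Y k :=
  fun s => prism (ev (ord0, false) (cut s) x) (enum 'I_k.+1).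

Lemma remove_enum k (i : 'I_k.+2) :
  take i (enum 'I_k.+2) ++ drop i.+1 (enum 'I_k.+2) =
  map (lift i) (enum 'I_k.+1).
Proof.
apply: (@eq_from_nth _ ord0).
  by rewrite size_remove size_enum_ord // (size_map (lift i)) size_enum_ord.
move=> j; rewrite size_remove ?size_enum_ord // => jk.
rewrite nth_remove ?size_enum_ord // (nth_map ord0 _ (lift i)) ?size_enum_ord //.
apply: ord_inj; rewrite -[RHS]/(bump i (nth ord0 (enum 'I_k.+1) j)).
by rewrite !nth_enum_ord // /bump; lia.
Qed.

Lemma prism_map (E E' : Type) (g : E -> E') phi p :
  prism (fun q => phi (map (fun v => (g v.1, v.2)) q)) p = prism phi (map g p).
Proof.
elim: p phi => //= v p IH phi.
rewrite (IH (fun q => phi ((g v, false) :: q))); congr (phi _ + _).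
by rewrite -!map_comp.
Qed.

Lemma ev_level k b (x : cochain R Y k) (s : singular R Y k) :
  ev (ord0, false) (cut s) x (map (level b) (enum 'I_k.+1)) =
  x (slice b%:R s).
Proof.
rewrite /ev size_map size_enum_ord eqxx; congr x.
apply/continuousEP => w /=.
have E j : nth (ord0, false) (map (level b) (enum 'I_k.+1)) (j : 'I_k.+1) =
    (j, b).
  by rewrite (nth_map ord0) ?size_enum_ord // nth_ord_enum.
congr (H (_, s _)).
  rewrite (_ : snd \o _ = fun=> b); last by apply/funext => j /=; rewrite E.
  by case: b {E}; rewrite ?clock_true ?clock_false.
rewrite (_ : fst \o _ = id) ?simplex_map_id //.
by apply/funext => j /=; rewrite E.
Qed.

Lemma prism_cochain_formula k (x : cochain R Y k.+1) (s : singular R Y k.+1) :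
  prism_cochain (coboundary x) s + coboundary (prism_cochain x) s =
  x (slice 1 s) + x (slice 0 s).
Proof.
have := prism_formula (ev (ord0, false) (cut s) x) (enum 'I_k.+2).
rewrite !ev_level => <-; congr (_ + _).
  by apply: eq_prism => q; rewrite ev_coboundary //; exact: restrict_cut.
rewrite dbound_sum size_enum_ord; apply: eq_bigr => i _.
rewrite remove_enum -prism_map; apply: eq_prism => q.
rewrite /ev size_map; case: eqP => // sq; congr x.
apply/continuousEP => w /=; congr (H (_, _)).
  congr clock; apply/funext => j /=.
  by rewrite (nth_map (ord0, false)) ?sq.
rewrite -[LHS]/(s (simplex_map R (lift i) (simplex_map R _ w))) simplex_map_comp.
congr (s (simplex_map _ _ _)); apply/funext => j /=.
by rewrite (nth_map (ord0, false)) ?sq.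
Qed.

End Homotopy.

(** * Cochains on families of simplices *)

Section Families.
Variables (R : realType) (Y : topologicalType).
Local Notation cochain := (cochain R Y).
Local Notation singular := (singular R Y).
Implicit Types F Z P : set Y -> Prop.

Definition im n (s : singular n) : set Y := [set s w | w in setT].

(* A family of singular simplices is given by a property F of their images, and
   is closed under faces when F is hereditary. *)
Definition hereditary F := forall A B : set Y, A `<=` B -> F B -> F A.

Definition both F Z (A : set Y) := F A /\ Z A.

Lemma hereditary_both F Z :
  hereditary F -> hereditary Z -> hereditary (both F Z).
Proof. by move=> hF hZ A B AB [FB ZB]; split; [exact: hF FB|exact: hZ ZB]. Qed.

Lemma im_restrict k n (s : singular n) (f : 'I_k.+1 -> 'I_n.+1) :
  im (restrict s f) `<=` im s.
Proof. by move=> _ [w _ <-]; exists (simplex_map R f w). Qed.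

Lemma im_nonempty n (s : singular n) : im s !=set0.
Proof.
suff t : std_simplex R n by exists (s t), t.
exists (\row_j (j == ord0)%:R); apply/mem_set; split=> [i|]; rewrite ?mxE //.
rewrite (bigD1 ord0) //= mxE eqxx big1 ?addr0 // => i /negPf i0.
by rewrite mxE i0.
Qed.

(** Faces of [s] are indexed by lists of its vertices, so the identity is [dbound_dbound] at the
    full list. *)
Lemma coboundary_coboundary k (x : cochain k) : coboundary (coboundary x) = 0.
Proof.
apply/funext => s.
pose re j (p : 'I_j.+1 -> 'I_k.+3) := restrict s p.
have reE i j (f : 'I_i.+1 -> 'I_j.+1) (p : 'I_j.+1 -> 'I_k.+3) :
  restrict (re j p) f = re i (p \o f) by exact: restrict_comp.
have : ev ord0 re (coboundary (coboundary x)) (enum 'I_k.+3) = 0.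
  rewrite (ev_coboundary ord0 reE) (_ : ev _ _ _ = dbound (ev ord0 re x)).
    exact: dbound_dbound.
  by apply/funext => p; rewrite (ev_coboundary ord0 reE).
rewrite /ev size_enum_ord eqxx => e; apply: etrans e; rewrite /re (_ : (fun j => _) = id).
  by rewrite restrict_id.
by apply/funext => j; rewrite nth_ord_enum.
Qed.

Definition vanish F k (x : cochain k) :=
  forall s : singular k, F (im s) -> x s = 0.

Lemma sub_vanish F F' k (x : cochain k) :
  (forall A, F' A -> F A) -> vanish F x -> vanish F' x.
Proof. by move=> FF x0 s /FF /x0. Qed.

Lemma vanish0 F k : vanish F (0 : cochain k).
Proof. by []. Qed.

Lemma vanishD F k (x y : cochain k) :
  vanish F x -> vanish F y -> vanish F (x + y).
Proof. by move=> x0 y0 s Fs; rewrite -[LHS]/(x s + y s) x0 ?y0 ?addr0. Qed.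

Lemma vanishDr F k (x y : cochain k) :
  vanish F x -> vanish F (x + y) -> vanish F y.
Proof.
by move=> x0 y0 s Fs; rewrite -(y0 s Fs) -[RHS]/(x s + y s) x0 // add0r.
Qed.

Lemma vanish_coboundary F k (x : cochain k) : hereditary F ->
  vanish F x -> vanish F (coboundary x).
Proof.
move=> hF x0 s Fs; rewrite /coboundary big1 // => i _; apply: x0.
exact: hF (@im_restrict _ _ s _) Fs.
Qed.

Lemma face_value_vanish F k n (x : cochain k) (s : singular n) A :
  hereditary F -> vanish F x -> F (im s) -> face_value x s A = 0.
Proof.
move=> hF x0 Fs; rewrite /face_value; case: ifP => // _; apply: x0.
exact: hF (@im_restrict _ _ s _) Fs.
Qed.

Lemma vanish_cupl F c p q n (x : cochain p) (y : cochain q) :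
  hereditary F -> vanish F x -> vanish F (cup c x y : cochain n).
Proof.
move=> hF x0 s Fs; rewrite /cup big1 // => J _.
by rewrite (face_value_vanish _ hF) // mul0r.
Qed.

Lemma vanish_cupr F c p q n (x : cochain p) (y : cochain q) :
  hereditary F -> vanish F y -> vanish F (cup c x y : cochain n).
Proof.
move=> hF y0 s Fs; rewrite /cup big1 // => J _.
by rewrite [X in _ * X](face_value_vanish _ hF) // mulr0.
Qed.

(** Extension by zero from [F]: it turns data on [F] into a cochain of the whole space and, for
    hereditary [F], leaves the coboundary on [F] unchanged. *)
Definition cutoff F k (x : cochain k) : cochain k :=
  fun s => if pselect (F (im s)) then x s else 0.

Lemma cutoff_in F k (x : cochain k) s : F (im s) -> cutoff F x s = x s.
Proof. by rewrite /cutoff; case: pselect. Qed.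

Lemma cutoff_vanish F F' k (x : cochain k) :
  vanish (both F F') x -> vanish F' (cutoff F x).
Proof. by move=> x0 s Fs; rewrite /cutoff; case: pselect => // Fs'; exact: x0. Qed.

Lemma coboundary_cutoff F k (x : cochain k) s : hereditary F ->
  F (im s) -> coboundary (cutoff F x) s = coboundary x s.
Proof.
move=> hF Fs; apply: eq_bigr => i _; apply: cutoff_in.
exact: hF (@im_restrict _ _ s _) Fs.
Qed.

(* Mod 2 the equation x + dy = 0 on F says x = dy there; in degree 0 there are
   no coboundaries. *)
Definition rel_exact F Z l : cochain l -> Prop :=
  match l with
  | 0 => fun x => vanish F x
  | k.+1 => fun x => exists2 y : cochain k,
              vanish (both F Z) y & vanish F (x + coboundary y)
  end.

Lemma exact_vanish F Z l (x : cochain l) : vanish F x -> rel_exact F Z x.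
Proof.
case: l x => [|l] x x0 //; exists 0 => //.
by rewrite coboundary0 addr0.
Qed.

Lemma exactD F Z l (x y : cochain l) :
  rel_exact F Z x -> rel_exact F Z y -> rel_exact F Z (x + y).
Proof.
case: l x y => [|l] x y; first exact: vanishD.
move=> [u u0 xu] [v v0 yv]; exists (u + v); first exact: vanishD.
by rewrite coboundaryD addrACA; exact: vanishD.
Qed.

Lemma exactDr F Z l (x y : cochain l) :
  rel_exact F Z x -> rel_exact F Z (x + y) -> rel_exact F Z y.
Proof.
move=> ex exy; have := exactD ex exy.
by rewrite addrA cochain_addxx add0r.
Qed.

Lemma exact_coboundary F Z l (y : cochain l) :
  vanish (both F Z) y -> rel_exact F Z (coboundary y).
Proof. by move=> y0; exists y => //; rewrite cochain_addxx. Qed.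

Lemma exact_sub F F' Z Z' l (x : cochain l) :
  (forall A, F' A -> F A) -> (forall A, F' A -> Z' A -> Z A) ->
  rel_exact F Z x -> rel_exact F' Z' x.
Proof.
move=> FF ZZ; case: l x => [|l] x; first exact: sub_vanish.
case=> y y0 xy; exists y; last exact: sub_vanish xy.
by apply: sub_vanish y0 => A [FA ZA]; split; [exact: FF | exact: ZZ].
Qed.

(** In positive degree the witness is the coboundary of the primitive cut off to [F]: closed on the
    whole space, and zero on all of [Z] rather than only within [F]. *)
Lemma exact_cocycle F Z l (x : cochain l) : hereditary F -> hereditary Z ->
  rel_exact F Z x -> exists g : cochain l,
    [/\ coboundary g = 0, vanish Z g & vanish F (x + g)].
Proof.
move=> hF hZ; case: l x => [|l] x; first by exists 0; rewrite addr0 coboundary0.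
case=> y y0 xy; exists (coboundary (cutoff F y)); split.
- exact: coboundary_coboundary.
- exact/vanish_coboundary/cutoff_vanish.
- move=> s Fs; rewrite -[LHS]/(_ + _) coboundary_cutoff //.
  exact: xy.
Qed.

(** The cross terms form the symmetrised product of [x] and [y], which [cup c.+2 x y] bounds up to
    terms containing [coboundary x] or [coboundary y]. *)
Lemma exact_sqD F Z c p l (x y : cochain p) :
  hereditary F -> hereditary Z ->
  vanish F (coboundary x) -> vanish F (coboundary y) -> vanish (both F Z) x ->
  rel_exact F Z (cup c.+1 (x + y) (x + y) + (cup c.+1 x x + cup c.+1 y y)
             : cochain l.+1).
Proof.
move=> hF hZ dx dy x0.
exists (cup c.+2 x y); first by apply: vanish_cupl => //; exact: hereditary_both.
rewrite coboundary_cup cupDl !cupDr.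
set a := cup c.+1 x x; set b := cup c.+1 x y; set d := cup c.+1 y x.
set e := cup c.+1 y y; set f := cup _ _ _; set g := cup _ _ _.
have -> : a + b + (d + e) + (a + e) + (f + g + (b + d)) = f + g.
  by apply/funext => s; rewrite !fctE;
    move: (a s) (b s) (d s) (e s) (f s) (g s); f2.
by apply: vanishD; [exact: vanish_cupl | exact: vanish_cupr].
Qed.

(** Both summands on the right contribute [cup c b (coboundary b)] and its transpose, which cancel
    mod 2. *)
Lemma cup_coboundary_sq c p l (b : cochain p) :
  (cup c.+1 (coboundary b) (coboundary b) : cochain l.+1) =
  coboundary (cup c.+1 b (coboundary b) + cup c b b).
Proof.
rewrite coboundaryD coboundary_cup coboundary_coboundary cup0r addr0.
case: c => [|c]; first by rewrite !cup0 coboundary0 !addr0.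
rewrite coboundary_cup [cup c b b + _]cochain_addxx addr0.
rewrite -addrA [cup _ b _ + _]addrC.
by rewrite cochain_addxx addr0.
Qed.

(** Cohomologous cocycles have cohomologous squares: the cross terms are exact by [exact_sqD], the
    square of [coboundary b] by [cup_coboundary_sq]. *)
Lemma exact_sq_coboundary F Z c p l (a : cochain p.+1) (b : cochain p) :
  hereditary F -> hereditary Z ->
  vanish F (coboundary a) -> vanish (both F Z) b ->
  rel_exact F Z (cup c.+1 (a + coboundary b) (a + coboundary b) : cochain l.+1) ->
  rel_exact F Z (cup c.+1 a a : cochain l.+1).
Proof.
move=> hF hZ da b0 ex.
have hFZ := hereditary_both hF hZ.
have := @exact_sqD F Z c p.+1 l (coboundary b) a hF hZ.
rewrite coboundary_coboundary.
move=> /(_ (@vanish0 F _) da (vanish_coboundary hFZ b0)).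
rewrite [_ + a]addrC => /(exactDr ex).
apply: exactDr; rewrite cup_coboundary_sq; apply: exact_coboundary.
by apply: vanishD; exact: vanish_cupl.
Qed.

(* In the Mayer-Vietoris sequence of P1 and P2 relative to Z the class of a is
   the image of a class b on the intersection under the connecting map, which
   commutes with Steenrod operations. *)
Lemma exact_sq_desuspend P P1 P2 Z c k l (a : cochain k.+1) (b1 b2 : cochain k) :
  hereditary P -> hereditary P1 -> hereditary P2 -> hereditary Z ->
  (forall A, P1 A -> P A) -> (forall A, P2 A -> P A) ->
  (forall A, P A -> [\/ P1 A, P2 A | Z A]) ->
  vanish P (coboundary a) -> vanish (both P Z) a ->
  vanish (both P Z) b1 -> vanish (both P Z) b2 ->
  vanish P1 (a + coboundary b1) -> vanish P2 (a + coboundary b2) ->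
  (forall b : cochain k, vanish (both P1 P2) (coboundary b) ->
    vanish (both (both P1 P2) Z) b ->
    rel_exact (both P1 P2) Z (cup c b b : cochain l)) ->
  rel_exact P Z (cup c.+1 a a : cochain l.+1).
Proof.
move=> hP h1 h2 hZ s1 s2 PP da a0 b10 b20 ab1 ab2 IH.
apply: (exact_sq_coboundary (b := b2)) => //.
have hPZ := hereditary_both hP hZ.
have h12 := hereditary_both h1 h2.
(* [a'] vanishes on [P2] and agrees with [coboundary b] on [P1], so [b] is a cocycle on the
   intersection, whose class the connecting map sends to that of [a]. *)
pose b := b1 + b2; pose a' := a + coboundary b2.
have a'0 : vanish (both P Z) a' by exact/vanishD/vanish_coboundary.
have b0 : vanish (both P Z) b by exact: vanishD.
have a'b : vanish P1 (a' + coboundary b).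
  move=> s /ab1; rewrite /a' /b coboundaryD !fctE.
  by move: (a s) (coboundary b1 s) (coboundary b2 s); f2.
have db : vanish (both P1 P2) (coboundary b).
  move=> s [/a'b s1' /ab2 s2']; move: s1'.
  by rewrite -[LHS]/(a' s + _) [X in X + _](s2' : a' s = 0) add0r.
have bZ : vanish (both (both P1 P2) Z) b.
  by apply: sub_vanish b0 => A [[/s1]].
have [f [df fZ bf]] := exact_cocycle h12 hZ (IH b db bZ).
(* An explicit primitive of the square of [coboundary b]. On the intersection it reduces to
   [cup c b b], which [f] cancels, so [w0 + f] cut off to [P1] vanishes on [P2]. *)
pose w0 : cochain l := cup c.+1 b (coboundary b) + cup c b b.
exists (cutoff P1 (w0 + f)).
  apply: cutoff_vanish => s [_ [Ps Zs]]; rewrite -[LHS]/(w0 s + f s) fZ // addr0.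
  by rewrite -[LHS]/(_ + _) !(vanish_cupl (F := both P Z)) ?addr0.
have dw : coboundary (w0 + f) =
    (cup c.+1 (coboundary b) (coboundary b) : cochain l.+1).
  by rewrite coboundaryD df addr0 -cup_coboundary_sq.
have cup1 : vanish P1 (cup c.+1 a' a' + coboundary (w0 + f) : cochain l.+1).
  rewrite dw; set d := coboundary b.
  have -> : (cup c.+1 a' a' + cup c.+1 d d : cochain l.+1) =
      cup c.+1 (a' + d) a' + cup c.+1 d (a' + d).
    rewrite cupDl cupDr addrACA addrA; congr (_ + _).
    by rewrite -addrA cochain_addxx addr0.
  by apply: vanishD; [exact: vanish_cupl | exact: vanish_cupr].
have cup2 : vanish P2 (cup c.+1 a' a' : cochain l.+1) by exact: vanish_cupl.
have cupZ : vanish (both P Z) (cup c.+1 a' a' : cochain l.+1).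
  exact: vanish_cupl.
have w2 : vanish P2 (cutoff P1 (w0 + f)).
  apply: cutoff_vanish => s [P1s P2s]; rewrite -(bf s (conj P1s P2s)).
  rewrite -![RHS]/(_ + _) -![LHS]/(_ + _) -addrA [X in X + _ = _](_ : _ = 0) ?add0r //.
  by apply: (vanish_cupr (F := both P1 P2)).
have wZ : vanish (both P Z) (cutoff P1 (w0 + f)).
  apply: cutoff_vanish => s [_ [Ps Zs]]; rewrite -[LHS]/(w0 s + f s) fZ // addr0.
  by rewrite -[LHS]/(_ + _) !(vanish_cupl (F := both P Z)) ?addr0.
move=> s Ps; have [P1s|P2s|Zs] := PP _ Ps.
- by rewrite -[LHS]/(_ + _) coboundary_cutoff //; exact: cup1.
- by rewrite -[LHS]/(_ + _) cup2 // (vanish_coboundary h2 w2) // addr0.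
- by rewrite -[LHS]/(_ + _) cupZ // (vanish_coboundary hPZ wZ) // addr0.
Qed.

End Families.

(** * Homotopy invariance for pairs of families *)

Section RelativeHomotopy.
Variables (R : realType) (Y : topologicalType).
Local Notation cochain := (cochain R Y).
Local Notation singular := (singular R Y).

Definition sweep (H : R * Y -> Y) (A : set Y) : set Y :=
  [set H (t, p) | t in [set t | 0 <= t <= 1] & p in A].

Definition end_image (H : R * Y -> Y) (A : set Y) : set Y :=
  [set H (1, p) | p in A].

Variables (H : R * Y -> Y) (Hc : continuous H).

Lemma im_cut n (s : singular n) k (p : 'I_k.+1 -> 'I_n.+1 * bool) :
  im (cut Hc s p) `<=` sweep H (im s).
Proof.
move=> _ [w _ <-]; exists (clock (snd \o p) w); first exact: clock_itv.
by exists (s (simplex_map R (fst \o p) w)) => //; exists (simplex_map R (fst \o p) w).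
Qed.

Lemma im_slice n (s : singular n) t : 0 <= t <= 1 ->
  im (slice Hc t s) `<=` sweep H (im s).
Proof. by move=> t01 _ [w _ <-]; exists t => //; exists (s w) => //; exists w. Qed.

Lemma im_slice1 n (s : singular n) : im (slice Hc 1 s) `<=` end_image H (im s).
Proof. by move=> _ [w _ <-]; exists (s w) => //; exists w. Qed.

Lemma slice0_id n (s : singular n) :
  (forall p, im s p -> H (0, p) = p) -> slice Hc 0 s = s.
Proof.
move=> H0; apply/continuousEP => w.
by rewrite -[LHS]/(H (0, s w)) H0 //; exists w.
Qed.

Lemma prism_eq0 (E : Type) phi (p : seq E) :
  (forall q, phi q = 0) -> prism phi p = 0.
Proof.
elim: p phi => //= v p IH phi phi0.
by rewrite phi0 IH ?addr0 // => q; exact: phi0.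
Qed.

Lemma prism_vanish F k (x : cochain k.+1) (s : singular k) : hereditary F ->
  vanish F x -> F (sweep H (im s)) -> prism_cochain Hc x s = 0.
Proof.
move=> hF x0 Fs; apply: prism_eq0 => q; rewrite /ev; case: ifP => // _.
exact/x0/(hF _ _ (@im_cut _ _ _ _)).
Qed.

Lemma homotopic_cochain F k (x : cochain k.+1) : hereditary F ->
  (forall A, F A -> F (sweep H A)) ->
  (forall A p, F A -> A p -> H (0, p) = p) ->
  vanish F (coboundary x) ->
  vanish F (x + (fun s => x (slice Hc 1 s)) + coboundary (prism_cochain Hc x)).
Proof.
move=> hF HF H0 dx s Fs; have := prism_cochain_formula Hc x s.
rewrite (prism_vanish hF dx) ?add0r ?slice0_id //; last exact: HF.
  by rewrite !fctE => ->; move: (x _) (x _); f2.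
by move=> p; exact: H0.
Qed.

(** The homotopy contracts the pair into [Z], where [x] vanishes. The end slice thus contributes 0
    and the prism cochain is a primitive. *)
Lemma contract_exact F Z k (x : cochain k.+1) :
  hereditary F -> hereditary Z ->
  (forall A, F A -> F (sweep H A)) ->
  (forall A, F A -> Z A -> Z (sweep H A)) ->
  (forall A p, F A -> A p -> H (0, p) = p) ->
  (forall A, F A -> Z (end_image H A)) ->
  vanish F (coboundary x) -> vanish (both F Z) x -> rel_exact F Z x.
Proof.
move=> hF hZ HF HZ H0 H1 dx x0; have hFZ := hereditary_both hF hZ.
exists (prism_cochain Hc x).
  move=> s [Fs Zs]; apply: (prism_vanish hFZ x0).
  by split; [exact: HF | exact: HZ].
move=> s Fs; rewrite -(homotopic_cochain hF HF H0 dx Fs).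
rewrite -[LHS]/(x s + _) -[RHS]/(x s + _ + _) (_ : x (slice Hc 1 s) = 0) ?addr0 //.
apply: x0; split; last exact: hZ (@im_slice1 _ s) (H1 _ Fs).
by apply: hF (HF _ Fs); apply: im_slice; rewrite ler01 lexx.
Qed.

End RelativeHomotopy.

(** * The cohomology of a point *)

Section Constant.
Variables (R : realType) (Y : topologicalType) (y0 : Y).
Local Notation cochain := (cochain R Y).

Definition constant_simplex n : singular R Y n :=
  mkcts (@cst_continuous _ Y y0).

Lemma constant_simplexE n (s : singular R Y n) :
  im s `<=` [set y0] -> s = constant_simplex n.
Proof. by move=> sy; apply/continuousEP => w; apply: sy; exists w. Qed.

(** There is one simplex in each degree, so the coboundary out of degree j is multiplication by j +
    2 mod 2. For odd k it maps isomorphically onto degree k + 1; for even k the cocycle condition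
    forces [x] to be 0. *)
Lemma constant_exact Z k (x : cochain k.+1) :
  let P := fun A => A `<=` [set y0] in
  ~ Z [set y0] -> vanish P (coboundary x) -> rel_exact P Z x.
Proof.
move=> P ZF dx.
have P0 n : P (im (constant_simplex n)) by move=> _ [w _ <-].
have D j (y : cochain j) n : P (im n) ->
    coboundary y n = y (constant_simplex j) *+ j.+2.
  move=> Pn; rewrite /coboundary -[in RHS](card_ord j.+2) -sumr_const.
  apply: eq_bigr => i _; congr y; apply: constant_simplexE.
  exact: subset_trans (@im_restrict _ _ _ _ n _) Pn.
have F2odd (a : 'F_2) j : a *+ j = if odd j then a else 0.
  elim: j => [|j IH]; first by rewrite mulr0n.
  by rewrite mulrS IH /=; case: (odd j); rewrite /= ?addr0 ?F2_addxx.
exists (fun=> if odd k then x (constant_simplex k.+1) else 0) => s Ps.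
  case: Ps => Ps Zs; have [p [w _ sw]] := im_nonempty s; case: ZF.
  suff <- : im s = [set y0] by [].
  apply/seteqP; split=> // _ ->; rewrite -(_ : p = y0) ?sw; first by exists w.
  by apply: Ps; rewrite -sw; exists w.
rewrite -[LHS]/(_ + _) D // F2odd /= negbK (constant_simplexE Ps).
case: ifP => ok; first by rewrite ?ok F2_addxx.
have := dx _ (P0 k.+2); rewrite D ?F2odd /= ?ok ?addr0 //=; exact: P0.
Qed.

End Constant.

(** * Barycentric subdivision *)

Section SimplexGeometry.
Variables (R : realType) (n : nat).
Local Notation D := (std_simplex R n).

Lemma mix_simplex k (p : 'I_k -> D) (w : 'I_k -> R) :
  (forall i, 0 <= w i) -> \sum_i w i = 1 ->
  \sum_i w i *: set_val (p i) \in std_simplex R n.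
Proof.
move=> w0 w1; apply/mem_set; split=> [j|].
  rewrite summxE sumr_ge0 // => i _; rewrite mxE mulr_ge0 //.
  by have [h _] := set_valP (p i).
under eq_bigr do rewrite summxE.
rewrite exchange_big /= -w1; apply: eq_bigr => i _.
under eq_bigr do rewrite mxE.
by rewrite -mulr_sumr; have [_ ->] := set_valP (p i); rewrite mulr1.
Qed.

Lemma comb_simplex k (p : 'I_k.+1 -> D) (w : std_simplex R k) :
  \sum_i (set_val w : 'rV[R]_k.+1) ord0 i *: set_val (p i) \in std_simplex R n.
Proof. by have [w0 w1] := set_valP w; exact: mix_simplex. Qed.

Definition comb k (p : 'I_k.+1 -> D) (w : std_simplex R k) : D :=
  exist _ (\sum_i (set_val w : 'rV[R]_k.+1) ord0 i *: set_val (p i))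
    (comb_simplex p w).

Lemma vertex_simplex (i : 'I_n.+1) :
  \row_j (j == i)%:R \in std_simplex R n.
Proof.
apply/mem_set; split=> [j|]; first by rewrite mxE.
rewrite (bigD1 i) //= mxE eqxx big1 ?addr0 // => j /negPf ji.
by rewrite mxE ji.
Qed.

Definition vertex (i : 'I_n.+1) : D := exist _ (\row_j (j == i)%:R) (vertex_simplex i).

(** The default vertex serves the empty list, whose average is not a point of the simplex. *)
Definition barycenter (p : seq D) : D :=
  insubd (vertex ord0) ((size p)%:R^-1 *: \sum_(u <- p) set_val u).

Lemma val_barycenter p : (0 < size p)%N ->
  set_val (barycenter p) = (size p)%:R^-1 *: \sum_(u <- p) set_val u.
Proof.
move=> p0; rewrite /barycenter -[LHS]/(val _) val_insubd.
suff -> : (size p)%:R^-1 *: \sum_(u <- p) set_val u \in std_simplex R n by [].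
rewrite (big_nth (vertex ord0)) big_mkord scaler_sumr.
apply: mix_simplex => [i|]; first by rewrite invr_ge0.
by rewrite sumr_const card_ord -[LHS]mulr_natr mulVf // pnatr_eq0 -lt0n.
Qed.

Definition dist (u v : D) : R := `|set_val u - set_val v : 'rV[R]_n.+1|.

Lemma distC u v : dist u v = dist v u.
Proof. exact: distrC. Qed.

Lemma dist0 u : dist u u = 0.
Proof. by rewrite /dist subrr normr0. Qed.

Lemma dist_mix (x : D) k (p : 'I_k -> D) (w : 'I_k -> R) e :
  (forall i, 0 <= w i) -> \sum_i w i = 1 -> (forall i, dist x (p i) <= e) ->
  `|set_val x - \sum_i w i *: set_val (p i)| <= e.
Proof.
move=> w0 w1 xe.
rewrite -[set_val x]scale1r -w1 scaler_suml -sumrB.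
apply: (le_trans (ler_norm_sum _ _ _)).
rewrite -[leRHS]mul1r -w1 mulr_suml; apply: ler_sum => i _.
by rewrite -scalerBr normrZ ger0_norm // ler_wpM2l //; exact: xe.
Qed.

Lemma dist_comb (x : D) k (p : 'I_k.+1 -> D) (w : std_simplex R k) e :
  (forall i, dist x (p i) <= e) -> dist x (comb p w) <= e.
Proof. by have [w0 w1] := set_valP w; exact: dist_mix. Qed.

Lemma dist_barycenter (x : D) p e : (0 < size p)%N ->
  (forall u, u \in p -> dist x u <= e) -> dist x (barycenter p) <= e.
Proof.
move=> p0 xe; rewrite /dist val_barycenter //.
rewrite (big_nth (vertex ord0)) big_mkord scaler_sumr.
apply: dist_mix => [i||i]; first by rewrite invr_ge0.
  by rewrite sumr_const card_ord -[LHS]mulr_natr mulVf // pnatr_eq0 -lt0n.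
by apply: xe; rewrite mem_nth.
Qed.

(** In the average of the differences u - v over [p] the term v = u is zero, which leaves the factor
    (size p - 1) / size p. *)
Lemma dist_barycenter_mem N (p : seq D) u d : u \in p -> (size p <= N.+1)%N ->
  (forall v, v \in p -> dist u v <= d) ->
  dist u (barycenter p) <= N%:R / N.+1%:R * d.
Proof.
move=> up pN ud; have p0 : (0 < size p)%N by case: (p) up.
have d0 : 0 <= d by apply: le_trans (ud _ up); exact: normr_ge0.
have k0 : (size p)%:R != 0 :> R by rewrite pnatr_eq0 -lt0n.
rewrite /dist val_barycenter //.
have -> : set_val u - (size p)%:R^-1 *: \sum_(v <- p) set_val v =
    (size p)%:R^-1 *: \sum_(v <- p) (set_val u - set_val v).
  rewrite sumrB scalerBr big_const_seq count_predT iter_addr_0.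
  by rewrite -(scaler_nat (size p) (set_val u : 'rV[R]_n.+1)) scalerA mulVf // scale1r.
rewrite normrZ ger0_norm ?invr_ge0 // mulrC ler_pdivrMr ?ltr0n //.
apply: (@le_trans _ _ ((size p).-1%:R * d)).
  apply: (le_trans (ler_norm_sum _ _ _)); rewrite (big_rem u) //=.
  rewrite subrr normr0 add0r big_seq.
  apply: (@le_trans _ _ (\sum_(v <- rem u p | v \in rem u p) d)).
    by apply: ler_sum => v /mem_rem /ud.
  by rewrite -big_seq big_const_seq count_predT iter_addr_0 size_rem // mulr_natl.
rewrite mulrAC ler_wpM2r // mulrAC ler_pdivlMr ?ltr0n // -!natrM ler_nat.
by move: p0 pN; case: (size p) => // k _; rewrite /= ltnS; nia.
Qed.

End SimplexGeometry.

Section SimplexMaps.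
Variable R : realType.

Lemma comb_continuous n k (p : 'I_k.+1 -> std_simplex R n) : continuous (comb p).
Proof.
apply: (continuous_comp_initial (f := comb p)) => t.
have tF : Filter (nbhs t) := nbhs_filter t.
rewrite /continuous_at /comp /=.
apply: cvg_big => [|a _]; first exact: add_continuous.
apply: (@continuous_comp _ _ _ (@set_val _ (std_simplex R k))
  (fun M : 'rV[R]_k.+1 => M ord0 a *: (set_val (p a) : 'rV[R]_n.+1))).
  exact: initial_continuous.
move=> M; apply: (@continuous_comp _ _ _ (fun M : 'rV[R]_k.+1 => M ord0 a)
  (fun c : R => c *: (set_val (p a) : 'rV[R]_n.+1))).
  exact: coord_continuous.
exact: scalel_continuous.
Qed.

Lemma comb_comb n k j (p : 'I_k.+1 -> std_simplex R n)
    (q : 'I_j.+1 -> std_simplex R k) w :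
  comb p (comb q w) = comb (comb p \o q) w.
Proof.
apply/val_inj/rowP => l /=; rewrite !summxE.
under eq_bigr do rewrite mxE summxE mulr_suml.
rewrite exchange_big /=; apply: eq_bigr => i _.
rewrite mxE -[set_val (comb p (q i))]/(\sum_a set_val (q i) ord0 a *: set_val (p a)).
rewrite summxE mulr_sumr.
by apply: eq_bigr => a _; rewrite !mxE mulrA.
Qed.

Lemma comb_vertex_map n k (f : 'I_k.+1 -> 'I_n.+1) (w : std_simplex R k) :
  comb (fun i => vertex R (f i)) w = simplex_map R f w.
Proof.
apply/val_inj/rowP => j /=; rewrite summxE mxE [RHS]big_mkcond /=.
apply: eq_bigr => i _; rewrite !mxE eq_sym.
by case: eqP; rewrite ?mulr1 ?mulr0.
Qed.

Lemma comb_vertex n k (p : 'I_k.+1 -> std_simplex R n) i :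
  comb p (vertex R i) = p i.
Proof.
apply/val_inj => /=; rewrite (bigD1 i) //= mxE eqxx scale1r big1 ?addr0 //.
by move=> j /negPf ji; rewrite mxE ji scale0r.
Qed.

Lemma comb_barycenter n k (p : 'I_k.+1 -> std_simplex R n) q : (0 < size q)%N ->
  barycenter (map (comb p) q) = comb p (barycenter q).
Proof.
move=> q0; apply/val_inj => /=.
rewrite -[val (barycenter _)]/(set_val (barycenter _)) val_barycenter ?size_map //.
rewrite val_barycenter // big_map scaler_sumr.
under [RHS]eq_bigr do rewrite mxE summxE -scalerA scaler_suml.
by rewrite -scaler_sumr exchange_big scaler_sumr.
Qed.

(** Barycentric subdivision shrinks diameters by N / (N + 1). The convex condition [C] is a
    parameter so that the induction can strengthen it. *)
Lemma subdiv_small n N d phi (p : seq (std_simplex R n))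
    (C : std_simplex R n -> Prop) :
  (size p <= N.+1)%N ->
  (forall q, (0 < size q)%N -> (forall u, u \in q -> C u) -> C (barycenter q)) ->
  (forall u, u \in p -> C u) ->
  (forall u v, u \in p -> v \in p -> dist u v <= d) ->
  (forall q, size q = size p -> (forall u, u \in q -> C u) ->
     (forall u v, u \in q -> v \in q -> dist u v <= N%:R / N.+1%:R * d) ->
     phi q = 0) ->
  subdiv (@barycenter R n) phi p = 0.
Proof.
have [m] := ubnP (size p); elim: m => // m IH in p phi C *.
move=> pm pN convC pC pd phi0.
have [p0|p0] := posnP (size p).
  by rewrite /subdiv p0 /=; apply: phi0 => // u v; rewrite (size0nil p0).
rewrite subdivE // dbound_sum big1 // => i _.
set q := _ ++ _; set b := barycenter p.
have qp u : u \in q -> u \in p.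
  by rewrite mem_cat => /orP[/mem_take|/mem_drop].
have sq : (size q).+1 = size p by rewrite size_remove // prednK.
pose c := N%:R / N.+1%:R * d.
have bc u : u \in p -> dist u b <= c.
  by move=> up; apply: dist_barycenter_mem => // v; exact: pd.
(* The ball of radius [c] about [b] is closed under barycenters, so every vertex added later stays
   within [c] of [b]. *)
apply: (IH _ _ (fun u => C u /\ dist b u <= c)); rewrite -?sq //.
- by rewrite -ltnS sq.
- by rewrite -ltnS sq ltnW.
- move=> r r0 rC; split; first by apply: convC => // u /rC[].
  by apply: dist_barycenter => // u /rC[].
- by move=> u /qp up; split; [exact: pC | rewrite distC; exact: bc].
- by move=> u v /qp up /qp vp; exact: pd.
have c0 : 0 <= c.
  move: p0 bc; case: (p) => // u p' _ h; apply: le_trans (h u (mem_head _ _)).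
  exact: normr_ge0.
move=> r sr rC rd; apply: phi0 => /= [|u|u v]; first by rewrite sr.
  by rewrite inE => /orP[/eqP ->|/rC[]//]; exact: convC.
rewrite !inE => /orP[/eqP ->|ur] /orP[/eqP ->|vr].
- by rewrite dist0.
- by have [] := rC v vr.
- by rewrite distC; have [] := rC u ur.
- exact: rd.
Qed.

End SimplexMaps.

(** * Subdivision of singular cochains *)

Section SingularSubdivision.
Variables (R : realType) (Y : topologicalType).
Local Notation cochain := (cochain R Y).
Local Notation singular := (singular R Y).

Section Reparametrize.
Variables (n : nat) (s : singular n).

Lemma reparam_continuous k (p : 'I_k.+1 -> std_simplex R n) :
  continuous (fun w => s (comb p w)).
Proof.
by move=> w; apply: continuous_comp; [exact: comb_continuous | exact: cts_fun].
Qed.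

Definition reparam k (p : 'I_k.+1 -> std_simplex R n) : singular k :=
  mkcts (@reparam_continuous k p).

Lemma restrict_reparam j k (f : 'I_j.+1 -> 'I_k.+1)
    (p : 'I_k.+1 -> std_simplex R n) :
  restrict (reparam p) f = reparam (p \o f).
Proof.
apply/continuousEP => w.
rewrite -[LHS]/(s (comb p (simplex_map R f w))) -comb_vertex_map comb_comb.
by congr (s (comb _ _)); apply/funext => i /=; rewrite comb_vertex.
Qed.

Lemma im_reparam k (p : 'I_k.+1 -> std_simplex R n) : im (reparam p) `<=` im s.
Proof. by move=> _ [w _ <-]; exists (comb p w). Qed.

Definition evs k (x : cochain k) : seq (std_simplex R n) -> 'F_2 :=
  ev (vertex R ord0) reparam x.

Lemma evs_vanish F k (x : cochain k) p : hereditary F ->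
  F (im s) -> vanish F x -> evs x p = 0.
Proof.
move=> hF Fs x0; rewrite /evs /ev; case: ifP => // _; apply: x0.
exact: hF (@im_reparam _ _) Fs.
Qed.

End Reparametrize.

Definition vertices_seq k : seq (std_simplex R k) :=
  map (@vertex R k) (enum 'I_k.+1).

Lemma nth_vertices k (i : 'I_k.+1) :
  nth (vertex R ord0) (vertices_seq k) i = vertex R i.
Proof. by rewrite (nth_map ord0 _ (@vertex R k)) ?size_enum_ord // nth_ord_enum. Qed.

Lemma size_vertices k : size (vertices_seq k) = k.+1.
Proof. by rewrite size_map size_enum_ord. Qed.

Lemma reparam_vertices k (s : singular k) :
  reparam s (fun i : 'I_k.+1 => nth (vertex R ord0) (vertices_seq k) i) = s.
Proof.
apply/continuousEP => w.
rewrite -[LHS]/(s (comb _ w)); congr (s _).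
rewrite -[RHS]simplex_map_id -comb_vertex_map; congr comb.
by apply/funext => i; rewrite nth_vertices.
Qed.

Lemma evs_vertices k (x : cochain k) (s : singular k) :
  evs s x (vertices_seq k) = x s.
Proof. by rewrite /evs /ev size_vertices eqxx reparam_vertices. Qed.

Lemma evs_reparam n k j (x : cochain j) (s : singular n)
    (p : 'I_k.+1 -> std_simplex R n) q :
  evs (reparam s p) x q = evs s x (map (comb p) q).
Proof.
rewrite /evs /ev size_map; case: eqP => // sq; congr x.
apply/continuousEP => w.
rewrite -[LHS]/(s (comb p (comb _ w))) comb_comb; congr (s (comb _ _)).
apply/funext => i /=; rewrite (nth_map (vertex R ord0)) // sq; exact: ltn_ord.
Qed.

Definition sd k (x : cochain k) : cochain k :=
  fun s => subdiv (@barycenter R k) (evs s x) (vertices_seq k).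

Definition sd_homotopy k (x : cochain k.+1) : cochain k :=
  fun s => cone (@barycenter R k) (evs s x) (vertices_seq k).

Lemma sd_reparam n k (x : cochain k) (s : singular n)
    (p : 'I_k.+1 -> std_simplex R n) :
  sd x (reparam s p) =
  subdiv (@barycenter R n) (evs s x) [seq p i | i <- enum 'I_k.+1].
Proof.
rewrite /sd (_ : evs _ x = fun q => evs s x (map (comb p) q)); last first.
  by apply/funext => q; exact: evs_reparam.
rewrite (subdiv_map (bar' := @barycenter R n) (@comb_barycenter R n k p)).
rewrite /vertices_seq -map_comp; congr subdiv.
by apply: eq_map => i /=; rewrite comb_vertex.
Qed.

Lemma sd_homotopy_restrict n k (x : cochain k.+1) (s : singular n)
    (f : 'I_k.+1 -> 'I_n.+1) :
  sd_homotopy x (restrict s f) =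
  cone (@barycenter R n) (evs s x) [seq vertex R (f i) | i <- enum 'I_k.+1].
Proof.
have -> : restrict s f = reparam s (fun i => vertex R (f i)).
  by apply/continuousEP => w; rewrite -[RHS]/(s (comb _ w)) comb_vertex_map.
set p := fun i => vertex R (f i).
rewrite /sd_homotopy (_ : evs _ x = fun q => evs s x (map (comb p) q)); last first.
  by apply/funext => q; exact: evs_reparam.
rewrite (cone_map (bar' := @barycenter R n) (@comb_barycenter R n k p)).
rewrite /vertices_seq -map_comp; congr cone.
by apply: eq_map => i /=; rewrite comb_vertex.
Qed.

Lemma sd_formula k (x : cochain k.+1) (s : singular k.+1) :
  sd_homotopy (coboundary x) s + coboundary (sd_homotopy x) s = x s + sd x s.
Proof.
have := cone_formula (@barycenter R k.+1) (evs s x) (vertices_seq k.+1).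
rewrite evs_vertices => <-; congr (_ + _).
  congr cone; apply/funext => q.
  exact: (ev_coboundary _ (@restrict_reparam _ s)).
rewrite dbound_sum size_vertices; apply: eq_bigr => i _.
rewrite sd_homotopy_restrict; congr cone.
rewrite /vertices_seq -map_take -map_drop -map_cat remove_enum -map_comp.
by [].
Qed.

Lemma sd_homotopic F k (x : cochain k.+1) : hereditary F ->
  vanish F (coboundary x) -> vanish F (x + sd x + coboundary (sd_homotopy x)).
Proof.
move=> hF dx s Fs; have := sd_formula x s.
rewrite /sd_homotopy cone_eq0 => [|q]; last exact: evs_vanish hF Fs dx.
rewrite add0r -[_ x s + _]/(_ + _) => e.
by rewrite -[LHS]/(x s + sd x s + coboundary (sd_homotopy x) s) e F2_addxx.
Qed.

End SingularSubdivision.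

(** * The theorem on small simplices *)

Section SmallSimplices.
Variable R : realType.

Lemma simplex_compact n : compact (std_simplex R n).
Proof.
apply: (subclosed_compact _
  (@rV_compact R n.+1 (fun=> `[0, 1]%classic) (fun=> @segment_compact R 0 1))).
- rewrite (_ : std_simplex R n =
    \bigcap_(i in setT) [set t : 'rV[R]_n.+1 | 0 <= t ord0 i] `&`
    [set t | \sum_i t ord0 i = 1]); last first.
    by apply/seteqP; split=> t [t0 t1]; split=> // i; [move=> _ |]; exact: t0.
  apply: closedI.
    apply: closed_bigI => i _.
    apply: (@preimage_closed _ _ (fun t : 'rV[R]_n.+1 => t ord0 i) [set x | 0 <= x]).
      by move=> t _; exact: coord_continuous.
    exact: closed_ge.
  apply: (@preimage_closed _ _ (fun t : 'rV[R]_n.+1 => \sum_i t ord0 i) [set x | x = 1]).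
    move=> t _; have tF : Filter (nbhs t) := nbhs_filter t.
    apply: cvg_big => [|i _]; first exact: add_continuous.
    exact: coord_continuous.
  exact: closed_eq.
- move=> t [t0 t1] i; rewrite /= in_itv /= t0 -t1 (bigD1 i) //=.
  by rewrite lerDl sumr_ge0.
Qed.

Variable Y : pseudoMetricType R.
Local Notation cochain := (cochain R Y).
Local Notation singular := (singular R Y).

Definition small (e : R) (A : set Y) := forall p q, A p -> A q -> ball p e q.

(** The Heine-Cantor theorem on the compact simplex, through near-coverings: halving radii makes one
    [d] serve a whole neighbourhood of each point. *)
Lemma singular_unif_continuous n (s : singular n) e : 0 < e ->
  exists2 d, 0 < d & forall u v, dist u v <= d -> ball (s u) e (s v).
Proof.
move=> e0; pose P (d : R) (x : 'rV[R]_n.+1) :=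
  forall u v : std_simplex R n, set_val u = x -> dist u v <= d -> ball (s u) e (s v).
have cov := (compact_near_coveringP (std_simplex R n)).1 (@simplex_compact n).
have : \forall d \near (0 : R)^'+, std_simplex R n `<=` P d.
  apply: cov => x /mem_set Kx; pose u : std_simplex R n := exist _ x Kx.
  have e2 : 0 < e / 2 by rewrite divr_gt0.
  have /nbhs_ballP[r /= r0 rP] : nbhs u (s @^-1` ball (s u) (e / 2)).
    by apply: (@cts_fun _ _ s u); exact: nbhsx_ballx.
  have r2 : 0 < r / 2 by rewrite divr_gt0.
  have bu v : `|x - set_val v : 'rV[R]_n.+1| < r -> ball (s u) (e / 2) (s v).
    move=> xv; apply: rP; rewrite -initial_ballE.
    by rewrite /preimage /= mx_norm_ball.
  exists (ball x (r / 2), [set d | d < r / 2]) => /=.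
    by split; [exact: nbhsx_ballx | exact: nbhs_right_lt].
  move=> [x' d] /= [xx' dr] v w vx' vw.
  move: xx'; rewrite mx_norm_ball /ball_ /= -vx' => xv.
  rewrite [e]splitr; apply: (@ball_triangle _ _ (s u)).
    by apply/ball_sym/bu; apply: lt_trans xv _; lra.
  apply: bu; rewrite -(subrKA (set_val v : 'rV[R]_n.+1)).
  apply: (le_lt_trans (ler_normD _ _)).
  by move: vw; rewrite /dist => vw; lra.
move=> dP; have /filter_ex[d [d0 Pd]] :
    \forall d \near (0 : R)^'+, 0 < d /\ std_simplex R n `<=` P d.
  by apply: filterI => //; exact: nbhs_right_gt.
by exists d => // u v uv; apply: (Pd (set_val u)) => //; exact: set_valP.
Qed.

Lemma dist_bounded n : exists B : R, forall u v : std_simplex R n, dist u v <= B.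
Proof.
exists (\sum_i \sum_j dist (vertex R i : std_simplex R n) (vertex R j)) => u v.
have E (w : std_simplex R n) : w = comb (@vertex R n) w.
  by rewrite -[LHS]simplex_map_id -comb_vertex_map.
rewrite (E v); apply: dist_comb => j; rewrite distC (E u).
apply: dist_comb => i; rewrite distC (bigD1 i) //= (bigD1 j) //= -addrA lerDl.
by apply: addr_ge0; apply: sumr_ge0 => a _;
  [exact: normr_ge0 | apply: sumr_ge0 => b _; exact: normr_ge0].
Qed.

(** Each subdivision gains a factor k / (k + 1), whose powers tend to 0. The bound [i0] is uniform
    in [p] because the standard simplex has finite diameter. *)
Lemma iter_sd_small F e k (x : cochain k) n (s : singular n) :
  hereditary F -> F (im s) -> 0 < e -> vanish (both F (small e)) x ->
  exists i0, forall i, (i0 <= i)%N -> forall p : 'I_k.+1 -> std_simplex R n,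
    iter i (@sd R Y k) x (reparam s p) = 0.
Proof.
move=> hF Fs e0 x0; have [d d0 ds] := singular_unif_continuous s e0.
pose c : R := k%:R / k.+1%:R.
have c0 : 0 <= c by rewrite divr_ge0.
have claim i D (p : 'I_k.+1 -> std_simplex R n) :
    (forall a b, dist (p a) (p b) <= D) -> c ^+ i * D <= d ->
    iter i (@sd R Y k) x (reparam s p) = 0.
  elim: i D p => [|i IH] D p pD cD.
    apply: x0; split; first exact: hF (@im_reparam _ _ _ _ _ _) Fs.
    move=> _ _ [w _ <-] [w' _ <-]; apply: ds; apply: (@le_trans _ _ D).
      apply: dist_comb => j; rewrite distC; apply: dist_comb => l; exact: pD.
    by move: cD; rewrite expr0 mul1r.
  rewrite iterS sd_reparam.
  apply: (@subdiv_small R n k D _ _ (fun=> True)) => //.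
  - by rewrite size_map size_enum_ord.
  - by move=> u v /mapP[a _ ->] /mapP[b _ ->].
  - move=> q; rewrite size_map size_enum_ord => sq _ qD.
    rewrite /evs /ev sq eqxx; apply: (IH (c * D)) => [a b|].
      by apply: qD; rewrite mem_nth // sq ltn_ord.
    by rewrite mulrA -exprSr.
have [B BP] := dist_bounded n.
have c1 : `|c| < 1.
  by rewrite ger0_norm // ltr_pdivrMr ?ltr0n // mul1r ltr_nat.
have B0 : 0 <= B by apply: le_trans (BP (vertex R ord0) (vertex R ord0)); exact: normr_ge0.
have B1 : 0 < B + 1 by rewrite ltr_wpDl.
have := cvg_expr c1 => /cvgrPdist_lt /(_ (d / (B + 1))).
rewrite divr_gt0 // => /(_ isT)[i0 _ ci]; exists i0 => i i0i p.
apply: (claim _ B) => [a b|]; first exact: BP.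
have := ci i i0i; rewrite /= sub0r normrN ger0_norm ?exprn_ge0 //.
rewrite ltr_pdivlMr // mulrDr mulr1 => h.
by apply: ltW; apply: le_lt_trans h; rewrite lerDl exprn_ge0.
Qed.

(** The number of subdivisions that makes a simplex small depends on the simplex. The primitive is
    therefore the infinite sum of the homotopies between successive subdivisions, which is finite on
    each simplex of [F]. *)
Lemma small_simplices F e k (x : cochain k.+1) : hereditary F -> 0 < e ->
  vanish F (coboundary x) -> vanish (both F (small e)) x ->
  exists y : cochain k, vanish F (x + coboundary y).
Proof.
move=> hF e0 dx x0; pose a i : cochain k.+1 := iter i (@sd R Y k.+1) x.
have da i : vanish F (coboundary (a i)).
  elim: i => [|i IH] //.
  have := vanish_coboundary hF (sd_homotopic hF IH).
  rewrite !coboundaryD coboundary_coboundary addr0; exact: vanishDr.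
pose b m : cochain k := \sum_(i < m) sd_homotopy (a i).
have bE m : vanish F (x + a m + coboundary (b m)).
  elim: m => [|m IH].
    by rewrite /b big_ord0 coboundary0 addr0 /a /= cochain_addxx.
  have := vanishD IH (sd_homotopic hF (da m)).
  rewrite /b big_ord_recr /= coboundaryD -/(b m) -/(a m.+1).
  set u := coboundary _; set v := coboundary _.
  have -> : x + a m + u + (a m + sd (a m) + v) = x + a m.+1 + (u + v).
    rewrite -[sd (a m)]/(a m.+1); apply/funext => s; rewrite !fctE.
    by move: (x s) (a m s) (u s) (a m.+1 s) (v s); f2.
  by [].
have stab (t : singular k) : F (im t) ->
    {m | forall i, (m <= i)%N -> sd_homotopy (a i) t = 0}.
  move=> Ft; apply: cid; have [m mP] := iter_sd_small hF Ft e0 x0.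
  exists m => i mi; apply: cone_eq0 => q; rewrite /evs /ev.
  by case: ifP => // _; exact: mP.
pose m t := if pselect (F (im t)) is left Ft then sval (stab t Ft) else 0%N.
have mP t i : F (im t) -> (m t <= i)%N -> sd_homotopy (a i) t = 0.
  by move=> Ft; rewrite /m; case: pselect => // Ft'; exact: (svalP (stab t Ft')).
have bm t M : F (im t) -> (m t <= M)%N -> b M t = b (m t) t.
  move=> Ft; elim: M => [|M IH]; first by rewrite leqn0 => /eqP ->.
  rewrite leq_eqVlt => /orP[/eqP <- //|mM].
  rewrite /b big_ord_recr /= -/(b M) -[LHS]/(b M t + _) mP // addr0.
  exact: IH.
exists (fun t => b (m t) t) => s Fs.
have Fr (i : 'I_k.+2) : F (im (restrict s (lift i))) by exact: hF (@im_restrict _ _ _ _ _ _) Fs.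
have [i0 i0P] := iter_sd_small hF Fs e0 x0.
(* [M] exceeds the thresholds of all faces of [s], so on them the infinite sum equals [b M]; by the
   choice of [i0], [a M] is 0 on [s]. *)
pose M := (i0 + \sum_(i < k.+2) m (restrict s (lift i)))%N.
have := bE M s Fs; rewrite !fctE (_ : a M s = 0) ?addr0 => [<-|]; last first.
  by rewrite -[s]reparam_vertices; apply: i0P; exact: leq_addr.
congr (_ + _); apply: eq_bigr => i _; rewrite bm //.
by rewrite /M (bigD1 i) //=; lia.
Qed.

End SmallSimplices.

(** * Moving points of the polydisc *)

Section Push.
Variables (R : realType) (X Y : topologicalType) (g : X -> Y).
Hypothesis gc : continuous g.

Lemma push_continuous n (s : singular R X n) : continuous (fun w => g (s w)).
Proof. by move=> w; apply: continuous_comp; [exact: cts_fun | exact: gc]. Qed.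

Definition push n (s : singular R X n) : singular R Y n :=
  mkcts (@push_continuous n s).

Definition pull k (x : cochain R Y k) : cochain R X k := fun s => x (push s).

Lemma im_push n (s : singular R X n) : im (push s) = [set g p | p in im s].
Proof.
apply/seteqP; split=> [_ [w _ <-]|_ [_ [w _ <-] <-]]; last by exists w.
by exists (s w) => //; exists w.
Qed.

Lemma restrict_push k n (s : singular R X n) (f : 'I_k.+1 -> 'I_n.+1) :
  restrict (push s) f = push (restrict s f).
Proof. exact/continuousEP. Qed.

Lemma coboundary_pull k (x : cochain R Y k) :
  coboundary (pull x) = pull (coboundary x).
Proof.
by apply/funext => s; apply: eq_bigr => i _; rewrite /pull restrict_push.
Qed.

Lemma cup_pull c p q n (x : cochain R Y p) (y : cochain R Y q) :
  cup c (pull x) (pull y) = pull (cup c x y : cochain R Y n).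
Proof.
apply/funext => s; apply: eq_bigr => J _.
by rewrite /face_value /pull !restrict_push.
Qed.

Lemma sq_pull n k (x : cochain R Y k) :
  sq_cochain n (pull x) = pull (sq_cochain n x).
Proof. by rewrite /sq_cochain; case: ifP => // _; rewrite cup_pull. Qed.

Lemma vanish_pull (F : set X -> Prop) (G : set Y -> Prop) k
    (x : cochain R Y k) :
  (forall A, F A -> G [set g p | p in A]) -> vanish G x -> vanish F (pull x).
Proof. by move=> FG x0 s Fs; apply: x0; rewrite im_push; exact: FG. Qed.

Lemma exact_pull (F F' : set X -> Prop) (G G' : set Y -> Prop) l
    (x : cochain R Y l) :
  (forall A, F A -> G [set g p | p in A]) ->
  (forall A, F A -> F' A -> G' [set g p | p in A]) ->
  rel_exact G G' x -> rel_exact F F' (pull x).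
Proof.
move=> FG FG'; case: l x => [|l] x; first exact: vanish_pull.
case=> y y0 xy; exists (pull y).
  by apply: vanish_pull y0 => A [FA F'A]; split; [exact: FG | exact: FG'].
by rewrite coboundary_pull; exact: (vanish_pull FG xy).
Qed.

End Push.

(** * Homotopies acting on chosen planar coordinates *)

Section PlanarMoves.
Variables (R : realType) (m : nat).
Local Notation Y := 'M[R]_(m, 2).
Implicit Types (A : set Y) (S : {set 'I_m}) (C : set (R * R)).

Definition xy (p : Y) (i : 'I_m) : R * R := (p i ord0, p i ord_max).

Lemma xy_inj (p q : Y) : (forall i, xy p i = xy q i) -> p = q.
Proof.
move=> pq; apply/matrixP => i j; have [e0 e1] := pq i.
by case: j => -[|[|//]] jP; [move: e0|move: e1];
  congr (_ = _); congr fun_of_matrix; apply/val_inj.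
Qed.

Definition of_xy (v : 'I_m -> R * R) : Y :=
  \matrix_(i, j) if j == ord0 then (v i).1 else (v i).2.

Lemma xy_of v i : xy (of_xy v) i = v i.
Proof. by rewrite /xy !mxE /=; case: (v i). Qed.

Lemma xy_continuous i : continuous (fun p : Y => xy p i).
Proof. by apply: continuous_pair; exact: coord_continuous. Qed.

Lemma of_xy_continuous (T : topologicalType) (v : T -> 'I_m -> R * R) :
  (forall i, continuous (fun t => v t i)) -> continuous (fun t => of_xy (v t)).
Proof.
move=> vc t A [P /= nP PA].
pose B (ij : 'I_m * 'I_2) (u : T) := P ij.1 ij.2 (of_xy (v u) ij.1 ij.2).
have tF : Filter (nbhs t) := nbhs_filter t.
suff H : nbhs t (fun u => forall ij, B ij u).
  by apply: filterS H => u Bu; apply: PA => i j; exact: (Bu (i, j)).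
apply: (filter_forall tF) => -[i j]; rewrite /B /=.
have : continuous (fun u => of_xy (v u) i j).
  move=> u; rewrite /of_xy; under eq_fun do rewrite mxE.
  case: (j == ord0); apply: continuous_comp; try exact: vc;
    [exact: cvg_fst | exact: cvg_snd].
by move=> /(_ t _ (nP i j)).
Qed.

Definition move S (f : R * (R * R) -> R * R) (tp : R * Y) : Y :=
  of_xy (fun i => if i \in S then f (tp.1, xy tp.2 i) else xy tp.2 i).

Lemma xy_move S f tp i :
  xy (move S f tp) i = if i \in S then f (tp.1, xy tp.2 i) else xy tp.2 i.
Proof. exact: xy_of. Qed.

Lemma move_continuous S f : continuous f -> continuous (move S f).
Proof.
move=> fc; apply: of_xy_continuous => i.
have c2 : continuous (fun tp : R * Y => xy tp.2 i).
  move=> tp; apply: (@continuous_comp _ _ _ snd (fun p => xy p i)).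
    exact: cvg_snd.
  exact: xy_continuous.
case: (i \in S) => // tp.
apply: (@continuous_comp _ _ _ (fun tp : R * Y => (tp.1, xy tp.2 i)) f).
  by apply: continuous_pair => // ?; exact: cvg_fst.
exact: fc.
Qed.

Definition at_ (i : 'I_m) C A := forall p, A p -> C (xy p i).

Lemma hereditary_at i C : hereditary (at_ i C).
Proof. by move=> A B AB BC p /AB /BC. Qed.

Lemma at_mono i C C' A : (forall z, C z -> C' z) -> at_ i C A -> at_ i C' A.
Proof. by move=> CC hA p /hA /CC. Qed.

Definition stable (f : R * (R * R) -> R * R) C :=
  forall t z, 0 <= t <= 1 -> C z -> C (f (t, z)).

Lemma at_sweep S f i C A : (i \in S -> stable f C) ->
  at_ i C A -> at_ i C (sweep (move S f) A).
Proof.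
move=> fC hA _ [t t01 [p Ap <-]]; rewrite xy_move /=.
by case: ifP => [/fC|_]; [apply => //|]; exact: hA.
Qed.

Lemma at_end S f i C A : i \in S -> (forall p, A p -> C (f (1, xy p i))) ->
  at_ i C (end_image (move S f) A).
Proof. by move=> iS hA _ [p Ap <-]; rewrite xy_move iS; exact: hA. Qed.

Lemma move0 S f p : (forall i, i \in S -> f (0, xy p i) = xy p i) ->
  move S f (0, p) = p.
Proof.
by move=> f0; apply: xy_inj => i; rewrite xy_move /=; case: ifP => // /f0.
Qed.

End PlanarMoves.

Section ContinuousReal.
Variables (R : realType) (T : topologicalType).
Implicit Types f g : T -> R.

Lemma cts_add f g :
  continuous f -> continuous g -> continuous (fun z => f z + g z).
Proof. by move=> fc gc z; apply: cvgD; [exact: fc | exact: gc]. Qed.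

Lemma cts_mul f g :
  continuous f -> continuous g -> continuous (fun z => f z * g z).
Proof. by move=> fc gc z; apply: cvgM; [exact: fc | exact: gc]. Qed.

Lemma cts_opp f : continuous f -> continuous (fun z => - f z).
Proof. by move=> fc z; apply: cvgN; exact: fc. Qed.

Lemma cts_cst (a : R) : continuous (fun _ : T => a).
Proof. exact: cst_continuous. Qed.

Lemma cts_sqr f : continuous f -> continuous (fun z => f z ^+ 2).
Proof. by move=> fc; apply: cts_mul. Qed.

Lemma cts_sqrt f : continuous f -> continuous (fun z => Num.sqrt (f z)).
Proof.
move=> fc z; apply: (continuous_comp (fc z)); exact: sqrt_continuous.
Qed.

Lemma cts_max f g :
  continuous f -> continuous g -> continuous (fun z => Num.max (f z) (g z)).
Proof. by move=> fc gc z; apply: continuous_max; [exact: fc | exact: gc]. Qed.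

Lemma cts_min f g :
  continuous f -> continuous g -> continuous (fun z => Num.min (f z) (g z)).
Proof. by move=> fc gc z; apply: continuous_min; [exact: fc | exact: gc]. Qed.

Lemma cts_inv f : (forall z, f z != 0) -> continuous f ->
  continuous (fun z => (f z)^-1).
Proof. by move=> f0 fc z; apply: cvgV; [exact: f0 | exact: fc]. Qed.

End ContinuousReal.

Lemma cts_time (R : realType) : continuous (fun z : R * (R * R) => z.1).
Proof. by move=> z; exact: cvg_fst. Qed.

Lemma cts_x (R : realType) : continuous (fun z : R * (R * R) => z.2.1).
Proof.
move=> z; apply: (@continuous_comp _ _ _ snd fst); first exact: cvg_snd.
exact: cvg_fst.
Qed.

Lemma cts_y (R : realType) : continuous (fun z : R * (R * R) => z.2.2).
Proof.
move=> z; apply: (@continuous_comp _ _ _ snd snd); exact: cvg_snd.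
Qed.

Lemma cts_cotime (R : realType) : continuous (fun z : R * (R * R) => 1 - z.1).
Proof. exact: cts_add (@cts_cst _ _ _) (cts_opp (@cts_time R)). Qed.

Lemma cts_sqnorm (R : realType) :
  continuous (fun z : R * (R * R) => z.2.1 ^+ 2 + z.2.2 ^+ 2).
Proof. exact: cts_add (cts_sqr (@cts_x R)) (cts_sqr (@cts_y R)). Qed.

Ltac nonneg := repeat first
  [ done | exact: sqr_ge0 | rewrite subr_ge0 | apply: addr_ge0
  | apply: mulr_ge0 ].

(** * Explicit homotopies of the disc *)

Section Planar.
Variable R : realType.
Implicit Types (z : R * R) (t e : R).

Definition sqnorm z := z.1 ^+ 2 + z.2 ^+ 2.
Definition diskP z := sqnorm z <= 1.
Definition circP z := sqnorm z = 1.
Definition oneP z := z = (1, 0).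
Definition rightP z := 0 <= z.1.
Definition quadrant e z := z.1 <= 0 /\ 0 <= e * z.2.
Definition neg_axis z := z.1 <= 0 /\ z.2 = 0.

(** The second coordinate shrinks linearly and the first is the nonnegative root that makes the
    squared norm interpolate linearly to 1. Hence the disc and the circle are both preserved. *)
Definition to_one (w : R * (R * R)) : R * R :=
  (Num.sqrt ((1 - w.1) * (w.2.1 ^+ 2 + w.2.2 ^+ 2) + w.1
             - ((1 - w.1) * w.2.2) ^+ 2),
   (1 - w.1) * w.2.2).

(** A slide along circles about the origin onto the vertical axis: the norm is kept while the first
    coordinate shrinks. The sign [e] selects the half-plane. *)
Definition to_axis e (w : R * (R * R)) : R * R :=
  ((1 - w.1) * w.2.1,
   e * Num.sqrt (w.2.1 ^+ 2 + w.2.2 ^+ 2 - ((1 - w.1) * w.2.1) ^+ 2)).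

Definition to_minus_one (w : R * (R * R)) : R * R :=
  (- Num.sqrt ((1 - w.1) * (w.2.1 ^+ 2 + w.2.2 ^+ 2) + w.1), 0).

(** This move does not preserve the circle, so it suits only a coordinate that is free to fill its
    disc. *)
Definition to_zero (w : R * (R * R)) : R * R := ((1 - w.1) * w.2.1, w.2.2).

Lemma to_one_continuous : continuous to_one.
Proof.
apply: continuous_pair; last exact: cts_mul (@cts_cotime R) (@cts_y R).
apply/cts_sqrt/cts_add; last exact/cts_opp/cts_sqr/cts_mul/cts_y/cts_cotime.
exact: cts_add (cts_mul (@cts_cotime R) (@cts_sqnorm R)) (@cts_time R).
Qed.

Lemma to_axis_continuous e : continuous (to_axis e).
Proof.
apply: continuous_pair; first exact: cts_mul (@cts_cotime R) (@cts_x R).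
apply: cts_mul (@cts_cst _ _ _) (cts_sqrt _).
apply: cts_add (@cts_sqnorm R) (cts_opp (cts_sqr _)).
exact: cts_mul (@cts_cotime R) (@cts_x R).
Qed.

Lemma to_minus_one_continuous : continuous to_minus_one.
Proof.
apply: continuous_pair; last exact: cts_cst.
apply/cts_opp/cts_sqrt.
exact: cts_add (cts_mul (@cts_cotime R) (@cts_sqnorm R)) (@cts_time R).
Qed.

Lemma to_zero_continuous : continuous to_zero.
Proof.
apply: continuous_pair; last exact: cts_y.
exact: cts_mul (@cts_cotime R) (@cts_x R).
Qed.

Lemma sqnorm_to_one t z : 0 <= t <= 1 ->
  sqnorm (to_one (t, z)) = (1 - t) * sqnorm z + t.
Proof.
move=> /andP[t0 t1]; rewrite {1}/sqnorm /= sqr_sqrtr ?subrK //.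
have -> : (1 - t) * (z.1 ^+ 2 + z.2 ^+ 2) + t - ((1 - t) * z.2) ^+ 2 =
  (1 - t) * z.1 ^+ 2 + (1 - t) * t * z.2 ^+ 2 + t by ring.
by nonneg.
Qed.

Lemma sqnorm_to_minus_one t z : 0 <= t <= 1 ->
  sqnorm (to_minus_one (t, z)) = (1 - t) * sqnorm z + t.
Proof.
move=> /andP[t0 t1]; rewrite {1}/sqnorm /= expr0n addr0 sqrrN sqr_sqrtr //.
by nonneg.
Qed.

Lemma sqnorm_to_axis e t z : e ^+ 2 = 1 -> 0 <= t <= 1 ->
  sqnorm (to_axis e (t, z)) = sqnorm z.
Proof.
move=> e1 /andP[t0 t1].
rewrite {1}/sqnorm /= [X in _ + X]exprMn e1 mul1r sqr_sqrtr; first by rewrite addrC subrK.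
have -> : z.1 ^+ 2 + z.2 ^+ 2 - ((1 - t) * z.1) ^+ 2 =
  t * (1 + (1 - t)) * z.1 ^+ 2 + z.2 ^+ 2 by ring.
by nonneg.
Qed.

Lemma mix1_le t a : 0 <= t <= 1 -> a <= 1 -> (1 - t) * a + t <= 1.
Proof. by move=> /andP[t0 t1] a1; nra. Qed.

Lemma to_one_disk : stable to_one diskP.
Proof.
by move=> t z t01 z1; rewrite /diskP sqnorm_to_one //; exact: mix1_le.
Qed.

Lemma to_one_circ : stable to_one circP.
Proof.
by move=> t z t01 z1; rewrite /circP sqnorm_to_one // z1 mulr1 subrK.
Qed.

Lemma to_one_right : stable to_one rightP.
Proof. by move=> t z _ _; exact: sqrtr_ge0. Qed.

Lemma to_one_one : stable to_one oneP.
Proof.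
move=> t z t01 ->; rewrite /oneP /to_one /= mulr0 expr1n expr0n /= addr0 subr0.
by rewrite mulr1 subrK sqrtr1.
Qed.

Lemma to_one0 z : rightP z -> to_one (0, z) = z.
Proof.
case: z => x y x0; rewrite /to_one /= subr0 !mul1r addr0 addrK sqrtr_sqr.
by rewrite ger0_norm.
Qed.

Lemma to_one1 z : to_one (1, z) = (1, 0).
Proof. by rewrite /to_one /= subrr !mul0r expr0n /= add0r subr0 sqrtr1. Qed.

Lemma to_minus_one_disk : stable to_minus_one diskP.
Proof.
by move=> t z t01 z1; rewrite /diskP sqnorm_to_minus_one //; exact: mix1_le.
Qed.

Lemma to_minus_one_circ : stable to_minus_one circP.
Proof.
by move=> t z t01 z1; rewrite /circP sqnorm_to_minus_one // z1 mulr1 subrK.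
Qed.

Lemma to_minus_one_neg : stable to_minus_one neg_axis.
Proof. by move=> t z _ _; split=> //=; rewrite oppr_le0 sqrtr_ge0. Qed.

Lemma to_minus_one_fixed t : to_minus_one (t, (-1, 0)) = (-1, 0).
Proof.
rewrite /to_minus_one /= expr0n addr0 sqrrN expr1n mulr1 subrK.
by rewrite sqrtr1.
Qed.

Lemma to_minus_one0 z : neg_axis z -> to_minus_one (0, z) = z.
Proof.
case: z => x y [/= x0 ->]; rewrite /to_minus_one /= subr0 mul1r expr0n !addr0.
by rewrite sqrtr_sqr ler0_norm // opprK.
Qed.

Lemma to_minus_one1 z : to_minus_one (1, z) = (-1, 0).
Proof. by rewrite /to_minus_one /= subrr mul0r add0r sqrtr1. Qed.

Section Axis.
Variables (e : R) (e1 : e ^+ 2 = 1).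

Lemma to_axis_disk : stable (to_axis e) diskP.
Proof. by move=> t z t01 z1; rewrite /diskP sqnorm_to_axis. Qed.

Lemma to_axis_circ : stable (to_axis e) circP.
Proof. by move=> t z t01 z1; rewrite /circP sqnorm_to_axis. Qed.

Lemma to_axis_quadrant : stable (to_axis e) (quadrant e).
Proof.
move=> t z /andP[t0 t1] [z0 _]; split=> /=.
  by rewrite mulr_ge0_le0 // subr_ge0.
by rewrite mulrA -expr2 e1 mul1r sqrtr_ge0.
Qed.

Lemma to_axis_right : stable (to_axis e) rightP.
Proof.
by move=> t z /andP[t0 t1] z0; rewrite /rightP /= mulr_ge0 // subr_ge0.
Qed.

Lemma to_axis0 z : quadrant e z -> to_axis e (0, z) = z.
Proof.
case: z => x y [/= x0 y0]; rewrite /to_axis /= subr0 mul1r addrAC subrr add0r.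
have -> : y ^+ 2 = (e * y) ^+ 2 by rewrite exprMn e1 mul1r.
by rewrite sqrtr_sqr ger0_norm // mulrA -expr2 e1 mul1r.
Qed.

Lemma to_axis1 z : rightP (to_axis e (1, z)).
Proof. by rewrite /rightP /= subrr mul0r. Qed.
End Axis.

Lemma to_zero_disk : stable to_zero diskP.
Proof.
move=> t [x y] /andP[t0 t1]; rewrite /diskP /sqnorm /= => h.
apply: le_trans h; rewrite lerD2r exprMn ler_piMl ?sqr_ge0 //.
by rewrite expr_le1 ?subr_ge0 // gerBl.
Qed.

Lemma to_zero_right : stable to_zero rightP.
Proof.
by move=> t z /andP[t0 t1] z0; rewrite /rightP /= mulr_ge0 // subr_ge0.
Qed.

Lemma to_zero_neg : stable to_zero neg_axis.
Proof.
move=> t z /andP[t0 t1] [z0 zy]; split=> //=.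
by rewrite mulr_ge0_le0 // subr_ge0.
Qed.

Lemma to_zero0 z : to_zero (0, z) = z.
Proof. by case: z => x y; rewrite /to_zero /= subr0 mul1r. Qed.

Lemma to_zero1 z : rightP (to_zero (1, z)).
Proof. by rewrite /rightP /= subrr mul0r. Qed.

(* At time t the strips |x| <= t/16 and |y| <= t/16 are flattened onto the axes
   and the result is pushed radially outwards, so that the circle stays fixed
   setwise. *)
Definition flatten (t x : R) := Num.max (x - t / 16) 0 + Num.min (x + t / 16) 0.
Definition flat_norm (w : R * (R * R)) :=
  Num.max (Num.sqrt (flatten w.1 w.2.1 ^+ 2 + flatten w.1 w.2.2 ^+ 2))
          (Num.max (1 - w.1 / 2) (1 / 2)).
Definition collapse (w : R * (R * R)) : R * R :=
  (flatten w.1 w.2.1 / flat_norm w, flatten w.1 w.2.2 / flat_norm w).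

(** The constant 1/2 keeps the denominator positive at every real time, since continuity is required
    on all of [R * (R * R)]. *)
Lemma flat_norm_gt0 w : 0 < flat_norm w.
Proof. by rewrite /flat_norm !lt_max divr_gt0 ?orbT. Qed.

Lemma flatten_continuous (h : R * (R * R) -> R) :
  continuous h -> continuous (fun w => flatten w.1 (h w)).
Proof.
have tc : continuous (fun w : R * (R * R) => w.1 / 16).
  exact: cts_mul (@cts_time R) (@cts_cst _ _ _).
move=> hc; apply: cts_add.
  exact: cts_max (cts_add hc (cts_opp tc)) (@cts_cst _ _ _).
exact: cts_min (cts_add hc tc) (@cts_cst _ _ _).
Qed.

Lemma collapse_continuous : continuous collapse.
Proof.
have fx := flatten_continuous (@cts_x R); have fy := flatten_continuous (@cts_y R).
have N0 w : flat_norm w != 0 by rewrite gt_eqF // flat_norm_gt0.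
have Nc : continuous (fun w => (flat_norm w)^-1).
  apply: (cts_inv N0); apply: cts_max.
    exact: cts_sqrt (cts_add (cts_sqr fx) (cts_sqr fy)).
  apply: cts_max (@cts_cst _ _ _); apply: cts_add (@cts_cst _ _ _) (cts_opp _).
  exact: cts_mul (@cts_time R) (@cts_cst _ _ _).
by apply: continuous_pair; exact: cts_mul.
Qed.

Lemma flatten0 x : flatten 0 x = x.
Proof.
rewrite /flatten mul0r subr0 addr0.
by have [x0|x0] := lerP x 0; rewrite ?add0r ?addr0.
Qed.

Lemma flatten_le0 x : x <= 1 / 16 -> flatten 1 x <= 0.
Proof.
move=> x16; rewrite /flatten.
by have [?|?] := lerP (x - 1 / 16) 0; have [?|?] := lerP (x + 1 / 16) 0; lra.
Qed.

Lemma flatten_ge0 x : - (1 / 16) <= x -> 0 <= flatten 1 x.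
Proof.
move=> x16; rewrite /flatten.
by have [?|?] := lerP (x - 1 / 16) 0; have [?|?] := lerP (x + 1 / 16) 0; lra.
Qed.

Lemma flatten_close t x : 0 <= t <= 1 -> `|flatten t x - x| <= t / 16.
Proof.
move=> /andP[t0 t1]; rewrite /flatten ler_norml.
by have [?|?] := lerP (x - t / 16) 0; have [?|?] := lerP (x + t / 16) 0;
  apply/andP; split; lra.
Qed.

Lemma sqr_close (x y d : R) : `|x - y| <= d -> `|y| <= 1 ->
  y ^+ 2 - 2 * d <= x ^+ 2.
Proof.
rewrite !ler_norml => /andP[xy1 xy2] /andP[y1 y2].
(* The two products add up to 2d + 2y(x - y), which gives y(x - y) >= -d. *)
have h1 : 0 <= (1 - y) * (d - (x - y)) by rewrite mulr_ge0 ?subr_ge0.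
have h2 : 0 <= (1 + y) * (d + (x - y)) by rewrite mulr_ge0 //; lra.
have h3 : 0 <= (x - y) ^+ 2 by exact: sqr_ge0.
have -> : x ^+ 2 = (x - y) ^+ 2 + 2 * (y * (x - y)) + y ^+ 2 by ring.
have e : (1 - y) * (d - (x - y)) + (1 + y) * (d + (x - y)) =
  2 * d + 2 * (y * (x - y)) by ring.
by move: h1 h2 e h3; lra.
Qed.

Lemma sqnorm_collapse w :
  sqnorm (collapse w) = (flatten w.1 w.2.1 ^+ 2 + flatten w.1 w.2.2 ^+ 2)
                        / flat_norm w ^+ 2.
Proof. by rewrite /sqnorm /= !exprMn -mulrDl exprVn. Qed.

Lemma collapse_disk w : diskP (collapse w).
Proof.
rewrite /diskP sqnorm_collapse ler_pdivrMr ?exprn_gt0 ?flat_norm_gt0 // mul1r.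
set s := _ + _; have s0 : 0 <= s by rewrite addr_ge0 ?sqr_ge0.
rewrite -[leLHS](sqr_sqrtr s0) ler_sqr ?nnegrE ?sqrtr_ge0 ?(ltW (flat_norm_gt0 w)) //.
by rewrite /flat_norm -/s le_max lexx.
Qed.

(** Above this threshold [flat_norm] is the norm of the flattened point, so dividing by it lands on
    the circle. *)
Lemma collapse_circP w :
  Num.max (1 - w.1 / 2) (1 / 2) ^+ 2 <=
    flatten w.1 w.2.1 ^+ 2 + flatten w.1 w.2.2 ^+ 2 ->
  circP (collapse w).
Proof.
set s := flatten _ _ ^+ 2 + _ => h; rewrite /circP sqnorm_collapse -/s.
have M0 : 0 < Num.max (1 - w.1 / 2) (1 / 2) by rewrite lt_max divr_gt0 ?orbT.
have s0 : 0 < s by apply: lt_le_trans h; rewrite exprn_gt0.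
have -> : flat_norm w = Num.sqrt s.
  apply/max_idPl; rewrite -[leLHS](ger0_norm (ltW M0)) -sqrtr_sqr.
  exact: ler_wsqrtr.
by rewrite sqr_sqrtr ?ltW // divff // gt_eqF.
Qed.

Lemma circ_abs z : circP z -> `|z.1| <= 1 /\ `|z.2| <= 1.
Proof.
rewrite /circP /sqnorm => z1; split;
  rewrite -(@ler_sqr _ `|_|) ?nnegrE // real_normK ?num_real // expr1n -z1.
  by rewrite lerDl sqr_ge0.
by rewrite lerDr sqr_ge0.
Qed.

(** Flattening moves each coordinate by at most t/16, so the squared norm stays at least 1 - t/4,
    which is at least (1 - t/2)^2. *)
Lemma collapse_circ : stable collapse circP.
Proof.
move=> t z t01 z1; have [x1 y1] := circ_abs z1; apply: collapse_circP => /=.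
have hx := sqr_close (flatten_close z.1 t01) x1.
have hy := sqr_close (flatten_close z.2 t01) y1.
move: z1; rewrite /circP /sqnorm => z1; move/andP: t01 => [t0 t1].
have -> : Num.max (1 - t / 2) (1 / 2) = 1 - t / 2 by apply/max_idPl; lra.
by nra.
Qed.

(** The distance to [z] and the flattening cost 1/16 each per coordinate, so the squared norm stays
    at least 1 - 1/2, above the threshold 1/4. *)
Lemma collapse_near_circ z z' : circP z ->
  `|z'.1 - z.1| <= 1 / 16 -> `|z'.2 - z.2| <= 1 / 16 ->
  circP (collapse (1, z')).
Proof.
move=> z1 hx hy; have [x1 y1] := circ_abs z1; apply: collapse_circP => /=.
have t01 : 0 <= (1 : R) <= 1 by rewrite ler01 lexx.
have cx := flatten_close z'.1 t01; have cy := flatten_close z'.2 t01.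
have hx' : `|flatten 1 z'.1 - z.1| <= 1 / 8.
  by move: cx hx; rewrite !ler_norml => /andP[? ?] /andP[? ?]; lra.
have hy' : `|flatten 1 z'.2 - z.2| <= 1 / 8.
  by move: cy hy; rewrite !ler_norml => /andP[? ?] /andP[? ?]; lra.
have sx := sqr_close hx' x1; have sy := sqr_close hy' y1.
move: z1; rewrite /circP /sqnorm => z1.
have -> : Num.max (1 - 1 / 2) (1 / 2) = 1 / 2 :> R by apply/max_idPr; lra.
by nra.
Qed.

Lemma collapse0 z : diskP z -> collapse (0, z) = z.
Proof.
rewrite /diskP /sqnorm => z1; case: z z1 => x y /= z1.
rewrite /collapse /flat_norm /= !flatten0 mul0r subr0.
have -> : Num.max 1 (1 / 2) = 1 :> R by apply/max_idPl; lra.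
have -> : Num.max (Num.sqrt (x ^+ 2 + y ^+ 2)) 1 = 1.
  by apply/max_idPr; rewrite -sqrtr1; exact: ler_wsqrtr.
by rewrite !divr1.
Qed.

End Planar.

(** * Desuspension of a coordinate *)

Lemma exact_sq_cochainD (R : realType) (Y : topologicalType)
    (F Z : set Y -> Prop) n k (x y : cochain R Y k) : (0 < n)%N ->
  hereditary F -> hereditary Z ->
  vanish F (coboundary x) -> vanish F (coboundary y) -> vanish (both F Z) x ->
  rel_exact F Z (sq_cochain n x) -> rel_exact F Z (sq_cochain n y) ->
  rel_exact F Z (sq_cochain n (x + y)).
Proof.
move=> n0 hF hZ dx dy x0; rewrite /sq_cochain; case: ifP => // _ ex ey.
apply: exactDr (exactD ex ey) _; clear ex ey; have : (0 < k + n)%N by lia.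
case: (k + n)%N => // l _; rewrite addrC; exact: exact_sqD.
Qed.

Section States.
Variables (R : realType) (m : nat) (K : {set {set 'I_m}}).
Local Notation Y := 'M[R]_(m, 2).
Implicit Types (A : set Y) (P U S T : {set 'I_m}) (L : {set {set 'I_m}}).

Definition supported L A := exists2 s, s \in L &
  forall i, i \notin s -> at_ i (@circP R) A.

Definition region i A :=
  [\/ at_ i (@rightP R) A, at_ i (quadrant 1) A | at_ i (quadrant (- 1)) A].

(* Coordinates in U are unconstrained up to the choice of one of three sectors,
   those in P lie on the segment [-1, 0], the others are at the base point. *)
Definition local P U i A :=
  if i \in U then region i A
  else if i \in P then at_ i (@neg_axis R) A else at_ i (@oneP R) A.

Definition state P U A :=
  [/\ forall i, at_ i (@diskP R) A, supported K A & forall i, local P U i A].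

(** The relative part: for a coordinate confined to [-1, 0], lying in the right half-plane means
    being 0. *)
Definition right_some P A := exists2 i, i \in P & at_ i (@rightP R) A.

Lemma hereditary_supported L : hereditary (supported L).
Proof.
by move=> A B AB [s sL sB]; exists s => // i /sB; exact: hereditary_at.
Qed.

Lemma hereditary_region i : hereditary (region i).
Proof.
move=> A B AB [] h; [constructor 1 | constructor 2 | constructor 3];
  exact: hereditary_at h.
Qed.

Lemma hereditary_local P U i : hereditary (local P U i).
Proof.
move=> A B AB; rewrite /local; case: ifP => _; first exact: hereditary_region.
by case: ifP => _; exact: hereditary_at.
Qed.

Lemma hereditary_state P U : hereditary (state P U).
Proof.
move=> A B AB [dB sB lB]; split.
- by move=> i; exact: hereditary_at (dB i).
- exact: hereditary_supported sB.
- by move=> i; exact: hereditary_local (lB i).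
Qed.

Lemma hereditary_right_some P : hereditary (right_some P).
Proof. by move=> A B AB [i iP iB]; exists i => //; exact: hereditary_at iB. Qed.

Hint Resolve hereditary_both hereditary_at hereditary_state
  hereditary_right_some : core.

Lemma supported_sweep L S f A : stable f (@circP R) ->
  supported L A -> supported L (sweep (move S f) A).
Proof. by move=> fC [s sL sA]; exists s => // i /sA; exact: at_sweep. Qed.

Lemma local_sweep P U i S f A : (i \in S -> local P U i (sweep (move S f) A)) ->
  local P U i A -> local P U i (sweep (move S f) A).
Proof.
have [|iS _] := boolP (i \in S); first by move=> _ h _; exact: h.
have E C : at_ i C A -> at_ i C (sweep (move S f) A).
  by apply: at_sweep; rewrite (negPf iS).
rewrite /local; case: ifP => _; last by case: ifP => _; exact: E.
by move=> [] /E h; [constructor 1 | constructor 2 | constructor 3].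
Qed.

Lemma state_sweep P U S f A :
  stable f (@diskP R) -> stable f (@circP R) ->
  (forall i, i \in S -> local P U i (sweep (move S f) A)) ->
  state P U A -> state P U (sweep (move S f) A).
Proof.
move=> fd fc fl [dA sA lA]; split.
- by move=> i; exact: at_sweep.
- exact: supported_sweep.
- by move=> i; apply: local_sweep => // iS; exact: fl.
Qed.

Lemma right_some_sweep P S f A : stable f (@rightP R) ->
  right_some P A -> right_some P (sweep (move S f) A).
Proof. by move=> fr [i iP iA]; exists i => //; exact: at_sweep. Qed.

Definition base_proj i (p : Y) : Y :=
  move [set i] (fun=> (1, 0)) ((0 : R), p).

Lemma base_proj_continuous i : continuous (base_proj i).
Proof.
move=> p; apply: (@continuous_comp _ _ _ (fun p : Y => ((0 : R), p))
  (move [set i] (fun=> (1, 0)))).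
  by apply: continuous_pair; [exact: cst_continuous | move=> q; exact: cvg_id].
by apply: move_continuous; exact: (@cst_continuous _ (R * R)%type).
Qed.

Lemma at_base_proj i j C A : (j = i -> C (1, 0)) -> (j != i -> at_ j C A) ->
  at_ j C [set base_proj i p | p in A].
Proof.
move=> c1 cA _ [p Ap <-]; rewrite xy_move inE.
by case: eqVneq => [/c1|/cA] => // h; exact: h.
Qed.

Lemma base_proj_id i (p : Y) : oneP (xy p i) -> base_proj i p = p.
Proof. by move=> p1; apply: move0 => j; rewrite inE => /eqP ->. Qed.

Lemma one_disk : diskP ((1, 0) : R * R).
Proof. by rewrite /diskP /sqnorm /= expr1n expr0n addr0. Qed.

Lemma one_circ : circP ((1, 0) : R * R).
Proof. by rewrite /circP /sqnorm /= expr1n expr0n addr0. Qed.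

Lemma state_base_proj P U i A : i \notin P ->
  state P U A -> state P (U :\ i) [set base_proj i p | p in A].
Proof.
move=> iP [dA [s sK sA] lA]; split.
- by move=> j; apply: at_base_proj => // _; exact: one_disk.
- exists s => // j js; apply: at_base_proj => _; first exact: one_circ.
  exact: sA.
move=> j; have := lA j; rewrite /local !inE.
have [-> _|ji] /= := eqVneq j i.
  by rewrite (negPf iP); apply: at_base_proj => //; rewrite eqxx.
have E C : at_ j C A -> at_ j C [set base_proj i p | p in A].
  by move=> h; apply: at_base_proj => // /eqP; rewrite (negPf ji).
case: ifP => _; last by case: ifP => _; exact: E.
by move=> [] /E h; [constructor 1 | constructor 2 | constructor 3].
Qed.

Lemma state_unfix P U i A : i \in U -> i \notin P ->
  state P (U :\ i) A -> state P U A.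
Proof.
move=> iU iP [dA sA lA]; split=> // j; have := lA j; rewrite /local !inE.
have [->|//] := eqVneq j i; rewrite /= iU (negPf iP) => h; constructor 1.
by apply: at_mono h => z ->; exact: ler01.
Qed.

(** The upper and lower left quadrants meet in the negative axis, which turns coordinate [i] from
    unprocessed into a segment coordinate. *)
Lemma state_quadrants P U i A : i \in U -> i \notin P ->
  state (i |: P) (U :\ i) A <->
  both (both (state P U) (at_ i (quadrant 1)))
       (both (state P U) (at_ i (quadrant (- 1)))) A.
Proof.
move=> iU iP; split=> [[dA sA lA]|[[[dA sA lA] q1] [_ q2]]].
  have nA : at_ i (@neg_axis R) A.
    by have := lA i; rewrite /local !inE eqxx.
  have q e : at_ i (quadrant e) A.
    by apply: at_mono nA => z [z1 z2]; split=> //; rewrite z2 mulr0.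
  have N : state P U A.
    split=> // j; have := lA j; rewrite /local !inE.
    by have [->|//] := eqVneq j i; rewrite /= iU; constructor 2.
  by [].
split=> // j; have := lA j; rewrite /local !inE.
have [-> _|//] := eqVneq j i; move=> /= p Ap.
have [x0 y0] := q1 p Ap; have [_ y1] := q2 p Ap; split=> //.
by apply/eqP; rewrite eq_le; apply/andP; split; lra.
Qed.

Lemma right_someU P i A :
  right_some (i |: P) A <-> at_ i (@rightP R) A \/ right_some P A.
Proof.
split=> [[j]|[iA|[j jP jA]]].
- by rewrite !inE => /orP[/eqP -> | jP] jA; [left | right; exists j].
- by exists i; rewrite // !inE eqxx.
- by exists j; rewrite // !inE jP orbT.
Qed.

Variable n : nat.
Hypothesis n0 : (0 < n)%N.

Definition sq_vanishes P U := forall k (a : cochain R Y k),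
  vanish (state P U) (coboundary a) ->
  vanish (both (state P U) (right_some P)) a ->
  rel_exact (state P U) (right_some P) (sq_cochain n a).

(* A class vanishing on the right half discs at i is supported on the two left
   quadrants, each of which contracts onto its vertical edge, where the class
   vanishes: it desuspends to their intersection. *)
Lemma sq_vanishes_desuspend P U i k (x : cochain R Y k.+1) :
  i \in U -> i \notin P -> sq_vanishes (i |: P) (U :\ i) ->
  vanish (state P U) (coboundary x) ->
  vanish (both (state P U) (right_some (i |: P))) x ->
  rel_exact (state P U) (right_some (i |: P)) (sq_cochain n x).
Proof.
move=> iU iP IH dx x0; rewrite /sq_cochain; case: ifP => [nk|_]; last first.
  by apply: (@exact_vanish _ _ _ _ (k.+1 + n)).
have hN := @hereditary_state P U; have hZ := @hereditary_right_some (i |: P).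
pose N e := both (state P U) (at_ i (quadrant e)).
have hNe e : hereditary (N e) by exact: hereditary_both.
have contract (e : R) : e ^+ 2 = 1 ->
    (forall A, at_ i (quadrant e) A -> region i A) ->
    exists2 b : cochain R Y k, vanish (both (state P U) (right_some (i |: P))) b
      & vanish (N e) (x + coboundary b).
  move=> e1 eR.
  have : rel_exact (N e) (right_some (i |: P)) x.
    apply: (contract_exact (H := move [set i] (to_axis e))) => //.
    - exact/move_continuous/to_axis_continuous.
    - move=> A [sA qA]; have qs : at_ i (quadrant e) (sweep (move [set i] (to_axis e)) A).
        by apply: at_sweep => // _; exact: to_axis_quadrant.
      split=> //; apply: state_sweep => //.
      + exact: to_axis_disk.
      + exact: to_axis_circ.
      + by move=> j; rewrite inE => /eqP ->; rewrite /local iU; exact: eR.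
    - by move=> A _; apply: right_some_sweep; exact: to_axis_right.
    - move=> A p [_ qA] Ap; apply: move0 => j; rewrite inE => /eqP ->.
      by apply: to_axis0 => //; exact: qA.
    - move=> A _; exists i; first by rewrite !inE eqxx.
      by apply: at_end; [rewrite inE | move=> p _; exact: to_axis1].
    - by apply: sub_vanish dx => A [].
    - by apply: sub_vanish x0 => A [[]].
  case=> b b0 xb; exists (cutoff (N e) b).
    apply: (@sub_vanish _ _ (right_some (i |: P))); first by move=> A [].
    exact: cutoff_vanish.
  move=> s Ns; rewrite -[LHS]/(_ + _) coboundary_cutoff //; exact: xb.
have [b1 b10 xb1] := contract 1 (expr1n _ _)
  (fun A h => Or32 _ _ h).
have [b2 b20 xb2] := contract (- 1) (etrans (sqrrN 1) (expr1n _ _))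
  (fun A h => Or33 _ _ h).
apply: (exact_sq_desuspend (P1 := N 1) (P2 := N (- 1)) hN (hNe _) (hNe _) hZ
  _ _ _ dx x0 b10 b20 xb1 xb2).
- by move=> A [].
- by move=> A [].
- move=> A sA; have [_ _ /(_ i)] := sA; rewrite /local iU => -[] h.
  + by constructor 3; apply/right_someU; left.
  + by constructor 1.
  + by constructor 2.
(* Desuspension lowers the number of cut vertices by one. This gives the cochain of Sq^n in degree
   k, or [cup 0], which is 0, when n = k + 1. *)
move=> b db b0; have [kn|kn] := leqP n k; last first.
  by rewrite (_ : k.+1 - n = 0)%N ?cup0; [exact: exact_vanish | lia].
have SQ A : both (N 1) (N (- 1)) A <-> state (i |: P) (U :\ i) A.
  by have [h1 h2] := @state_quadrants P U i A iU iP; split.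
apply: (exact_sub (F := state (i |: P) (U :\ i)) (Z := right_some (i |: P))) => //.
  by move=> A /SQ.
have := IH k b; rewrite /sq_cochain kn subSn //; apply.
  by apply: sub_vanish db => A /SQ.
by apply: sub_vanish b0 => A [/SQ].
Qed.

(** Split [a] as x + y, with y pulled back along [base_proj i]. The part y comes from the family
    with coordinate [i] at the base point. The part x is exact over the right half disc, so after
    adding a coboundary it vanishes there and desuspends. *)
Lemma sq_vanishes_step P U i : i \in U -> i \notin P ->
  sq_vanishes (i |: P) (U :\ i) -> sq_vanishes P (U :\ i) -> sq_vanishes P U.
Proof.
move=> iU iP IH1 IH2 k a da a0.
case: k a da a0 => [|k] a da a0.
  by rewrite /sq_cochain leqNgt n0; exact: exact_vanish.
have hN := @hereditary_state P U; have hZ := @hereditary_right_some P.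
have ec := @base_proj_continuous i.
have NE A : state P U A -> state P U [set base_proj i p | p in A].
  by move=> sA; apply: (state_unfix iU iP); exact: state_base_proj.
have ZE A : right_some P A -> right_some P [set base_proj i p | p in A].
  case=> j jP jA; exists j => //; apply: at_base_proj => // ji.
  by move: jP; rewrite ji (negPf iP).
pose y := pull ec a; pose x := a + y.
have dy : vanish (state P U) (coboundary y).
  by rewrite coboundary_pull; exact: vanish_pull da.
have y0 : vanish (both (state P U) (right_some P)) y.
  by apply: vanish_pull a0 => A [sA zA]; split; [exact: NE | exact: ZE].
have dx : vanish (state P U) (coboundary x).
  by rewrite coboundaryD; exact: vanishD.
have x0 : vanish (both (state P U) (right_some P)) x by exact: vanishD.
have x1 : vanish (both (state P U) (at_ i (@oneP R))) x.
  move=> s [Ns s1]; rewrite -[LHS]/(a s + a (push ec s)).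
  rewrite (_ : push ec s = s) ?F2_addxx //; apply/continuousEP => w.
  by apply: base_proj_id; apply: s1; exists w.
have -> : a = x + y by rewrite /x -addrA cochain_addxx addr0.
apply: exact_sq_cochainD => //; last first.
  rewrite /y sq_pull; apply: (@exact_pull _ _ _ _ ec _ _ (state P (U :\ i)) (right_some P)).
  - by move=> A; exact: state_base_proj.
  - by move=> A _; exact: ZE.
  apply: IH2; first by apply: sub_vanish da => A; exact: state_unfix.
  by apply: sub_vanish a0 => A [sA zA]; split=> //; exact: (state_unfix iU iP).
pose F := both (state P U) (at_ i (@rightP R)).
(* The contraction of the right half disc ends where coordinate [i] is the base point; [x] vanishes
   there because [base_proj i] fixes such simplices. *)
pose Z A := right_some P A \/ at_ i (@oneP R) A.
have hF : hereditary F by exact: hereditary_both.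
have hZ' : hereditary Z.
  by move=> A B AB [h|h]; [left; exact: hZ h | right; exact: hereditary_at h].
have : rel_exact F Z x.
  apply: (contract_exact (H := move [set i] (@to_one R))) => //.
  - exact/move_continuous/to_one_continuous.
  - move=> A [sA rA].
    have rs : at_ i (@rightP R) (sweep (move [set i] (@to_one R)) A).
      by apply: at_sweep => // _; exact: to_one_right.
    split=> //; apply: state_sweep => //.
    + exact: to_one_disk.
    + exact: to_one_circ.
    + by move=> j; rewrite inE => /eqP ->; rewrite /local iU; constructor 1.
  - move=> A _ [zA|zA]; [left | right].
      by apply: right_some_sweep => //; exact: to_one_right.
    by apply: at_sweep => // _; exact: to_one_one.
  - move=> A p [_ rA] Ap; apply: move0 => j; rewrite inE => /eqP ->.
    by apply: to_one0; exact: rA.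
  - move=> A _; right; apply: at_end; first by rewrite inE.
    by move=> p _; exact: to_one1.
  - by apply: sub_vanish dx => A [].
  - by move=> s [[Ns _] [Zs|Zs]]; [exact: x0 | exact: x1].
case=> b b0 xb; pose c := cutoff F b.
have c0 : vanish (both (state P U) (right_some P)) c.
  apply: (@sub_vanish _ _ Z); first by move=> A [_ ?]; left.
  exact: cutoff_vanish.
have xc : vanish F (x + coboundary c).
  by move=> s Fs; rewrite -[LHS]/(_ + _) coboundary_cutoff //; exact: xb.
suff : rel_exact (state P U) (right_some P) (sq_cochain n (x + coboundary c)).
  rewrite /sq_cochain; case: ifP => [_|_ _]; last by apply: (@exact_vanish _ _ _ _ (k.+1 + n)).
  exact: exact_sq_coboundary.
(* A primitive vanishing on the larger family [right_some (i |: P)] also vanishes on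
   [right_some P]. *)
apply: (exact_sub (F := state P U) (Z := right_some (i |: P))) => //.
  by move=> A _ [j jP jA]; exists j; rewrite // !inE jP orbT.
apply: sq_vanishes_desuspend => //.
  by rewrite coboundaryD coboundary_coboundary addr0.
move=> s [Ns /right_someU[rs|zs]]; first exact: xc.
rewrite -[LHS]/(x s + coboundary c s) x0 // add0r.
by rewrite (vanish_coboundary (hereditary_both hN hZ) c0).
Qed.

Lemma sq_vanishes_all : (forall P, sq_vanishes P finset.set0) ->
  sq_vanishes finset.set0 [set: 'I_m]%SET.
Proof.
move=> base.
suff IH N P U : (#|U| < N)%N -> (forall i, i \in U -> i \notin P) ->
    sq_vanishes P U.
  by apply: (IH #|[set: 'I_m]%SET|.+1) => // i _; rewrite inE.
elim: N P U => // N IH P U UN PU.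
have [->|[i iU]] := set_0Vmem U; first exact: base.
have Ui : (#|U :\ i| < N)%N by move: UN; rewrite (cardsD1 i U) iU.
have iP := PU i iU.
apply: (sq_vanishes_step iU iP); apply: IH => // j; rewrite !inE => /andP[ji jU].
  by rewrite negb_or ji PU.
exact: PU.
Qed.

End States.

(** * Unions of cubes *)

Section Base.
Variables (R : realType) (m : nat) (P : {set 'I_m}).
Local Notation Y := 'M[R]_(m, 2).
Implicit Types (A : set Y) (T : {set 'I_m}) (L : {set {set 'I_m}}).

Hint Resolve hereditary_both hereditary_at hereditary_state
  hereditary_right_some : core.

(* The product of segments [-1, 0] over P, with the coordinates outside T kept
   on the circle. *)
Definition cubes T L A :=
  [/\ state L P finset.set0 A & forall i, i \notin T -> at_ i (@circP R) A].

Definition corner : Y := of_xy (fun i => if i \in P then (-1, 0) else (1, 0)).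

Lemma xy_corner i : xy corner i = if i \in P then (-1, 0) else (1, 0).
Proof. exact: xy_of. Qed.

Lemma circ_corner i : circP (xy corner i).
Proof.
by rewrite xy_corner; case: ifP => _; rewrite /circP /sqnorm /= ?sqrrN expr1n
  expr0n addr0.
Qed.

Lemma cubes_corner L s A : s \in L -> A `<=` [set corner] ->
  cubes finset.set0 L A.
Proof.
move=> sL Ac; have E i C : C (xy corner i) -> at_ i C A by move=> c p /Ac ->.
split=> [|i _]; last by apply: E; exact: circ_corner.
split=> [i||i].
- by apply: E; rewrite /diskP circ_corner.
- by exists s => // i _; apply: E; exact: circ_corner.
rewrite /local inE; case: ifP => iP; apply: E; rewrite xy_corner iP //.
by split=> //=; rewrite oppr_le0.
Qed.

Lemma corner_not_right : ~ right_some P [set corner].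
Proof.
by case=> i iP /(_ corner erefl); rewrite xy_corner iP /rightP /= oppr_ge0 ler10.
Qed.

(** The negative axis meets the circle only in (-1, 0). *)
Lemma cubes0 L A : cubes finset.set0 L A -> A `<=` [set corner].
Proof.
move=> [[_ _ lA] cA] p Ap; apply: xy_inj => i; rewrite xy_corner.
have := lA i; rewrite /local inE; case: ifP => _ => [nA|]; last exact.
have [x0 y0] := nA p Ap.
have : circP (xy p i) by apply: cA; rewrite ?inE.
rewrite /circP /sqnorm y0 expr0n addr0 => /eqP; rewrite sqrf_eq1 => /orP[] /eqP e.
  by move: x0; rewrite e ler10.
by rewrite [LHS]surjective_pairing e y0.
Qed.

Lemma hereditary_cubes T L : hereditary (cubes T L).
Proof.
move=> A B AB [sB cB]; split; first exact: hereditary_state sB.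
by move=> i /cB; exact: hereditary_at.
Qed.
Hint Resolve hereditary_cubes : core.

Lemma cubes_setD T L A i : cubes (T :\ i) L A ->
  cubes T L A /\ at_ i (@circP R) A.
Proof.
move=> [sA cA]; split; last by apply: cA; rewrite !inE eqxx.
by split=> // j jT; apply: cA; rewrite !inE negb_and jT orbT.
Qed.

Lemma cubes_setDI T L A i : cubes T L A -> at_ i (@circP R) A ->
  cubes (T :\ i) L A.
Proof.
move=> [sA cA] ciA; split=> // j; rewrite !inE negb_and negbK.
by move=> /orP[/eqP ->|/cA].
Qed.

Lemma cubes_sub T L L' A : {subset L <= L'} -> cubes T L A -> cubes T L' A.
Proof.
move=> LL [[dA [s sL sA] lA] cA]; split=> //; split=> //.
by exists s => //; exact: LL.
Qed.

(** This set need not be closed under faces: [supported] only asks for one member containing all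
    coordinates that leave the circle, so it describes the closed star. *)
Definition star L (i : 'I_m) := [set s in L | i \in s]%SET.

Lemma star_sub L i : {subset star L i <= L}.
Proof. by move=> s; rewrite inE => /andP[]. Qed.

Lemma cubes_star T L A i : cubes T L A ->
  cubes T (star L i) A \/ cubes (T :\ i) L A.
Proof.
move=> cA; have [[dA [s sL sA] lA] c] := cA.
have [is_|is_] := boolP (i \in s).
  by left; split=> //; split=> //; exists s => //; rewrite inE sL.
by right; apply: cubes_setDI => //; exact: sA.
Qed.

Lemma cubes_starI T L A i : cubes T (star L i) A -> cubes (T :\ i) L A ->
  cubes (T :\ i) (star L i) A.
Proof. by move=> c1 /cubes_setD[_ c2]; exact: cubes_setDI. Qed.

(* Removing the coordinate i glues the star of i, which contracts onto the face
   x_i = 0, to the complex of the faces avoiding i, along the link of i. *)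
Lemma cubes_exact T L l (a : cochain R Y l.+1) : T \subset P ->
  (forall s, s \in L -> #|s :&: T| <= l)%N ->
  vanish (cubes T L) (coboundary a) ->
  vanish (both (cubes T L) (right_some P)) a ->
  rel_exact (cubes T L) (right_some P) a.
Proof.
have [N] := ubnP #|T|; elim: N => // N IH in T L l a *.
rewrite ltnS => TN TP Ll da a0.
have hZ := @hereditary_right_some R m P.
have [T0|[i iT]] := set_0Vmem T.
  subst T; have [L0|[s sL]] := set_0Vmem L.
    by apply: exact_vanish => s [[_ [t]]]; rewrite L0 inE.
  apply: (exact_sub (F := fun A => A `<=` [set corner]) (Z := right_some P)) => //.
    by move=> A; exact: cubes0.
  apply: constant_exact; first exact: corner_not_right.
  by apply: sub_vanish da => A; exact: cubes_corner sL.
have Ti : (#|T :\ i| < N)%N by move: TN; rewrite (cardsD1 i) iT.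
have TiP : T :\ i \subset P by apply: fintype.subset_trans TP; exact: subD1set.
have sT (s : {set 'I_m}) : i \in s -> #|s :&: T| = #|s :&: (T :\ i)|.+1.
  by move=> si; rewrite (cardsD1 i) !inE si iT add1n finset.setIDA.
have hD := @hereditary_cubes (T :\ i) L.
have hG := @hereditary_cubes T (star L i).
(* Adding the coboundary of this primitive makes the class vanish wherever coordinate [i] stays on
   the circle. *)
have [c c0 ac] : rel_exact (cubes (T :\ i) L) (right_some P) a.
  apply: IH => //.
  - move=> s /Ll; apply: leq_trans; apply: subset_leq_card.
    by apply/fintype.subsetP => j; rewrite !inE => /and3P[-> _ ->].
  - by apply: sub_vanish da => A /cubes_setD[].
  - by apply: sub_vanish a0 => A [/cubes_setD[]].
pose a' := a + coboundary (cutoff (cubes (T :\ i) L) c).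
have cZ : vanish (right_some P) (cutoff (cubes (T :\ i) L) c) by exact: cutoff_vanish.
have a'D : vanish (cubes (T :\ i) L) a'.
  by move=> s Ds; rewrite -[LHS]/(_ + _) coboundary_cutoff //; exact: ac.
have a'0 : vanish (both (cubes T L) (right_some P)) a'.
  by apply: vanishD => //; apply: sub_vanish (vanish_coboundary hZ cZ) => A [].
have da' : vanish (cubes T L) (coboundary a').
  by rewrite coboundaryD coboundary_coboundary addr0.
suff ex : rel_exact (cubes T L) (right_some P) a'.
  apply: exactDr (exact_coboundary (F := cubes T L) (Z := right_some P) _) _.
    by apply: sub_vanish cZ => A [].
  by rewrite addrC; exact: ex.
have GL A : cubes T (star L i) A -> cubes T L A by exact/cubes_sub/star_sub.
(* On the star, coordinate [i] is free to leave the circle, so it slides to 0, which lies in the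
   relative part. *)
have [b b0 a'b] : rel_exact (cubes T (star L i)) (right_some P) a'.
  apply: (contract_exact (H := move [set i] (@to_zero R))) => //.
  - exact/move_continuous/to_zero_continuous.
  - move=> A [[dA [s]]]; rewrite inE => /andP[sL si] sA lA cA.
    have off j C : j != i -> at_ j C A -> at_ j C (sweep (move [set i] (@to_zero R)) A).
      by move=> ji; apply: at_sweep; rewrite inE (negPf ji).
    split; last by move=> j jT; apply: off (cA j jT); apply: contra jT => /eqP ->.
    split.
    + by move=> j; apply: at_sweep => // _; exact: to_zero_disk.
    + exists s; first by rewrite inE sL.
      by move=> j js; apply: off (sA j js); apply: contra js => /eqP ->.
    move=> j; apply: local_sweep => // ; rewrite inE => /eqP ->.
    have := lA i; rewrite /local inE (fintype.subsetP TP i iT) => h.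
    by apply: at_sweep h => _; exact: to_zero_neg.
  - by move=> A _; apply: right_some_sweep; exact: to_zero_right.
  - by move=> A p _ _; apply: move0 => j _; exact: to_zero0.
  - move=> A _; exists i; first exact: (fintype.subsetP TP i iT).
    by apply: at_end; [rewrite inE | move=> p _; exact: to_zero1].
  - by apply: sub_vanish da' => A /GL.
  - by apply: sub_vanish a'0 => A [/GL].
(* In degree 0 the bound leaves the star without members, so its family is empty; in positive degree
   the induction hypothesis applies to the link. *)
have link k (y : cochain R Y k) :
    (forall s, s \in star L i -> #|s :&: (T :\ i)| < k)%N ->
    vanish (cubes (T :\ i) (star L i)) (coboundary y) ->
    vanish (both (cubes (T :\ i) (star L i)) (right_some P)) y ->
    exists g : cochain R Y k, [/\ coboundary g = 0, vanish (right_some P) g &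
      vanish (cubes (T :\ i) (star L i)) (y + g)].
  case: k y => [|k] y yk dy y0.
    exists 0; split=> //; first exact: coboundary0.
    by move=> t [[_ [s /yk]]].
  by apply: exact_cocycle => //; apply: IH.
have cD A : cubes (T :\ i) (star L i) A ->
    cubes T (star L i) A /\ cubes (T :\ i) L A.
  move=> cA; split; first by have [] := cubes_setD cA.
  exact: cubes_sub (@star_sub L i) cA.
(* [b] is a cocycle on the link because [a'] vanishes there. The correction [g] makes [b + g] vanish
   on the link, so its extension by zero is a primitive off the star as well. *)
have [g [dg gZ bg]] : exists g : cochain R Y l,
    [/\ coboundary g = 0, vanish (right_some P) g &
      vanish (cubes (T :\ i) (star L i)) (b + g)].
  apply: link => [s|s /cD[s1 s2]|s [/cD[s1 _] s2]]; last by apply: b0.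
    by rewrite inE => /andP[/Ll sl si]; rewrite -sT.
  by have := a'b s s1; rewrite -[LHS]/(a' s + _) a'D // add0r.
pose b' := cutoff (cubes T (star L i)) (b + g).
exists b'.
  apply: (@sub_vanish _ _ (right_some P)); first by move=> A [].
  apply: cutoff_vanish; apply: vanishD => //.
  by apply: sub_vanish gZ => A [].
have b'D : vanish (cubes (T :\ i) L) b'.
  by apply: cutoff_vanish => s [s1 s2]; apply: bg; exact: cubes_starI.
move=> s /cubes_star-/(_ i)[Gs|Ds].
  rewrite -[LHS]/(_ + _) coboundary_cutoff // coboundaryD dg addr0.
  exact: a'b.
by rewrite -[LHS]/(_ + _) a'D // (vanish_coboundary hD b'D) // addr0.
Qed.

Variable K : {set {set 'I_m}}.
Hypothesis K0 : finset.set0 \in K.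

Lemma cubes_state A : cubes P K A <-> state K P finset.set0 A.
Proof.
split=> [[]//|sA]; split=> // i iP.
have [_ _ /(_ i)] := sA; rewrite /local inE (negPf iP).
by apply: at_mono => z ->; exact: one_circ.
Qed.

(* The product of segments contracts onto its corner, so a = dc there, and
   c cup a vanishes where a does. *)
Lemma square_exact l (a : cochain R Y l.+1) j :
  vanish (state K P finset.set0) (coboundary a) ->
  vanish (both (state K P finset.set0) (right_some P)) a ->
  rel_exact (state K P finset.set0) (right_some P) (cup 1 a a : cochain R Y j.+1).
Proof.
set N := state K P finset.set0; move=> da a0.
pose C A := A `<=` [set corner].
have hN : hereditary N by exact: hereditary_state.
have hC : hereditary C by move=> A B AB BC; exact: subset_trans AB BC.
have CN A : C A -> N A by move=> cA; have [] := cubes_corner K0 cA.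
have [y _ ay] : rel_exact C (fun=> False) a.
  by apply: constant_exact => //; apply: sub_vanish da => A; exact: CN.
have da' : vanish N (coboundary (a + coboundary y)).
  by rewrite coboundaryD coboundary_coboundary addr0.
(* [to_minus_one] carries the coordinates in [P] to -1, and the others already are at the base
   point, so everything contracts onto the corner. *)
have [z _ az] : rel_exact N C (a + coboundary y).
  apply: (contract_exact (H := move P (@to_minus_one R))) => //.
  - exact/move_continuous/to_minus_one_continuous.
  - move=> A NA; apply: state_sweep => //.
    + exact: to_minus_one_disk.
    + exact: to_minus_one_circ.
    + move=> i iP; have [_ _ /(_ i)] := NA; rewrite /local inE iP.
      by apply: at_sweep => _; exact: to_minus_one_neg.
  - move=> A _ cA _ [t t01 [p /cA -> <-]]; apply: xy_inj => i.
    by rewrite xy_move /= xy_corner; case: (i \in P); rewrite ?to_minus_one_fixed.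
  - move=> A p [_ _ lA] Ap; apply: move0 => i iP; apply: to_minus_one0.
    by have := lA i; rewrite /local inE iP; apply.
  - move=> A [_ _ lA] _ [p Ap <-]; apply: xy_inj => i.
    rewrite xy_move /= xy_corner; case: ifP => iP; first exact: to_minus_one1.
    by have := lA i; rewrite /local inE iP; apply.
  - by move=> s [_]; exact: ay.
have hNZ := hereditary_both hN (@hereditary_right_some R m P).
exists (cup 1 (y + z) a); first exact: vanish_cupr.
rewrite coboundary_cup !cup0 !addr0 addrA -cupDl coboundaryD addrA.
by apply: vanishD; [exact: vanish_cupl | exact: vanish_cupr].
Qed.

Lemma sq_vanishes_base d n : (forall s, s \in K -> #|s| <= d.+1)%N ->
  (0 < n)%N -> (d < n.*2)%N -> sq_vanishes R K n P finset.set0.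
Proof.
move=> Kd n0 dn k a da a0; rewrite /sq_cochain; case: ifP => nk; last first.
  by apply: (@exact_vanish _ _ _ _ (k + n)).
have hN := @hereditary_state R m K P finset.set0.
have hNZ := hereditary_both hN (@hereditary_right_some R m P).
have [kn|kn] := leqP k n.
  have -> : n = k by apply/eqP; rewrite eqn_leq nk kn.
  rewrite subnn; case: k a da a0 nk {kn} => [|k] a da a0 nk; first by lia.
  exact: square_exact.
(* From k > n and 2n > d follows k + n >= d + 2, so l is at least d + 1, the bound on the size of
   the simplices. *)
have sk : exists l, (k + n = l.+1)%N by exists (k + n).-1; lia.
have [l kl] := sk; have ld : (d < l)%N by lia.
rewrite kl.
apply: (exact_sub (F := cubes P K) (Z := right_some P)) => //.
  by move=> A /cubes_state.
apply: cubes_exact => //.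
- move=> s sK; apply: leq_trans (subset_leq_card (subsetIl s P)) _.
  by apply: leq_trans (Kd s sK) _.
- have h : vanish (state K P finset.set0)
      (coboundary (cup (k - n).+1 a a : cochain R Y l.+1)).
    rewrite coboundary_cup [cup (k - n) a a + _]cochain_addxx addr0.
    by apply: vanishD; [exact: vanish_cupl | exact: vanish_cupr].
  by apply: sub_vanish h => A /cubes_state.
- have h : vanish (both (state K P finset.set0) (right_some P))
      (cup (k - n).+1 a a : cochain R Y l.+1) by exact: vanish_cupl.
  by apply: sub_vanish h => A [/cubes_state].
Qed.

End Base.

(** * The moment-angle complex *)

Section MomentAngleCohomology.
Variables (R : realType) (m : nat) (K : simplicial_complex m).
Local Notation Y := 'M[R]_(m, 2).
Local Notation X := (moment_angle R K).
Implicit Types A : set Y.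

Definition inside A := A `<=` moment_angle_set K.

Lemma hereditary_inside : hereditary inside.
Proof. by move=> A B AB; exact: subset_trans. Qed.

Lemma moment_angleP (p : Y) : moment_angle_set K p <->
  exists2 s, s \in faces K &
    forall i, diskP (xy p i) /\ (i \notin s -> circP (xy p i)).
Proof.
have E i : \sum_j (row i p) ord0 j ^+ 2 = sqnorm (xy p i).
  rewrite big_ord_recl big_ord1 !mxE /sqnorm /=; congr (_ + p i _ ^+ 2).
  exact/val_inj.
split=> [[s /= sK sp]|[s sK sp]].
  exists s => // i; have := sp i; rewrite /disc /circle.
  case: ifP => _ /=; rewrite E; first by [].
  by move=> e; split=> [|_]; rewrite ?/diskP ?e.
exists s => //= i; have [d c] := sp i; case: ifP => [_|/negbT /c].
  by rewrite /disc /= E.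
by rewrite /circle /= E.
Qed.

Local Notation start := (state (faces K) finset.set0 [set: 'I_m]%SET).

Lemma start_inside A : start A -> inside A.
Proof.
move=> [dA [s sK sA] _] p Ap; apply/moment_angleP; exists s => // i.
by split=> [|js]; [exact: dA | exact: sA].
Qed.

Definition collapse_all := move [set: 'I_m]%SET (@collapse R).

Lemma inside_sweep A : inside A -> inside (sweep collapse_all A).
Proof.
move=> iA _ [t t01 [p /iA /moment_angleP[s sK sp] <-]].
apply/moment_angleP; exists s => // i; rewrite xy_move inE.
split; first exact: collapse_disk.
by move=> js; apply: collapse_circ => //; have [_] := sp i; exact.
Qed.

Lemma small_dist e A (p q : Y) i : small e A -> A p -> A q ->
  `|(xy q i).1 - (xy p i).1| <= e /\ `|(xy q i).2 - (xy p i).2| <= e.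
Proof.
move=> sA Ap Aq; have [_ h] := sA q p Aq Ap.
by split; apply: ltW; [exact: (h i ord0) | exact: (h i ord_max)].
Qed.

(** If some point has a coordinate above 1/16, smallness keeps that coordinate nonnegative on all of
    [A]; otherwise it is at most 1/16 and flattens to a value <= 0. This decides the sector. A
    simplex for one point serves all, since the other coordinates stay near the circle and are
    pushed onto it. *)
Lemma small_collapse A : A !=set0 -> inside A -> small (1 / 16) A ->
  start (end_image collapse_all A).
Proof.
move=> [p0 Ap0] iA sA.
have at1 i C : (forall p, A p -> C (collapse (1, xy p i))) ->
    at_ i C (end_image collapse_all A).
  by move=> h; apply: at_end; rewrite ?inE.
have N0 (z : R * R) : 0 < (flat_norm (1, z))^-1 by rewrite invr_gt0 flat_norm_gt0.
split=> [i||i].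
- by apply: at1 => p _; exact: collapse_disk.
- have /moment_angleP[s sK sp] := iA _ Ap0; exists s => // i js.
  apply: at1 => p Ap; have [hx hy] := small_dist i sA Ap0 Ap.
  by apply: (@collapse_near_circ _ (xy p0 i)) => //; have [_] := sp i; exact.
rewrite /local inE.
have [[p Ap px]|nx] := pselect (exists2 p, A p & 1 / 16 < (xy p i).1).
  constructor 1; apply: at1 => q Aq; rewrite /rightP /=.
  apply: mulr_ge0; last exact/ltW/N0.
  have [+ _] := small_dist i sA Ap Aq; rewrite ler_norml => /andP[h _].
  by apply: flatten_ge0; move: h px; rewrite /xy /=; lra.
have x0 q : A q -> (collapse (1, xy q i)).1 <= 0.
  move=> Aq /=; rewrite pmulr_lle0 //; apply: flatten_le0.
  by rewrite leNgt; apply/negP => qx; apply: nx; exists q.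
have [[p Ap py]|ny] := pselect (exists2 p, A p & 1 / 16 < (xy p i).2).
  constructor 2; apply: at1 => q Aq; split; first exact: x0.
  rewrite /= mul1r; apply: mulr_ge0; last exact/ltW/N0.
  have [_ +] := small_dist i sA Ap Aq; rewrite ler_norml => /andP[h _].
  by apply: flatten_ge0; move: h py; rewrite /xy /=; lra.
constructor 3; apply: at1 => q Aq; split; first exact: x0.
rewrite /= mulN1r oppr_ge0 pmulr_lle0 //; apply: flatten_le0.
by rewrite leNgt; apply/negP => qy; apply: ny; exists q.
Qed.

(** Correct [a] to vanish on [start], then replace it by its pullback along the end of the collapse.
    That pullback kills small simplices, hence is exact. *)
Lemma start_exact l (a : cochain R Y l.+1) :
  vanish inside (coboundary a) -> rel_exact start (fun=> False) a ->
  exists b : cochain R Y l, vanish inside (a + coboundary b).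
Proof.
move=> da [w _ aw]; have hI := hereditary_inside.
have hS := @hereditary_state R m (faces K) finset.set0 [set: 'I_m]%SET.
pose b := a + coboundary w.
have db : vanish inside (coboundary b).
  by rewrite coboundaryD coboundary_coboundary addr0.
have cc : continuous collapse_all by exact/move_continuous/collapse_continuous.
have H0 A p : inside A -> A p -> collapse_all (0, p) = p.
  move=> iA /iA /moment_angleP[s _ sp]; apply: move0 => i _.
  by apply: collapse0; have [] := sp i.
have bh := homotopic_cochain cc hI inside_sweep H0 db.
set g := (fun s => b _) in bh.
have dg : vanish inside (coboundary g).
  have := vanish_coboundary hI bh.
  rewrite (coboundaryD (b + g)) (coboundaryD b g) coboundary_coboundary addr0.
  by move=> h; exact: (vanishDr db h).
have g0 : vanish (both inside (small (1 / 16))) g.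
  move=> s [Is ss]; apply: aw; apply: hS (@im_slice1 _ _ _ cc _ s) _.
  by apply: small_collapse => //; exact: im_nonempty.
have e0 : 0 < 1 / 16 :> R by rewrite divr_gt0.
have [y gy] := small_simplices hI e0 dg g0.
exists (w + prism_cochain cc b + y) => s Is.
have := bh s Is; have := gy s Is.
rewrite (coboundaryD (w + _)) (coboundaryD w) /b !fctE.
set u := coboundary w s; set v := coboundary y s.
set p := coboundary (prism_cochain _ _) s.
by move: (a s) u v p (g s); f2.
Qed.

Lemma incl_continuous : continuous (set_val : X -> Y).
Proof. exact: initial_continuous. Qed.

Lemma push_incl_inj n : injective (@push R _ _ _ incl_continuous n).
Proof.
move=> s t st; apply/continuousEP => w; apply/val_inj.
exact: (congr1 (fun u : singular R Y n => u w) st).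
Qed.

Lemma inside_push n (t : singular R Y n) : inside (im t) ->
  exists s : singular R X n, push incl_continuous s = t.
Proof.
move=> It; have Iw w : t w \in moment_angle_set K.
  by apply/mem_set/It; exists w.
have c : continuous (fun w => exist _ (t w) (Iw w) : X).
  apply: (continuous_comp_initial (f := fun w => exist _ (t w) (Iw w) : X)).
  exact: cts_fun.
by exists (mkcts c); apply/continuousEP.
Qed.

Lemma im_push_inside n (s : singular R X n) :
  inside (im (push incl_continuous s)).
Proof. by move=> _ [w _ <-]; exact: set_valP (s w). Qed.

(** Extension by zero along the inclusion, which moves the problem from Z_K to simplices of the
    whole space (R^2)^m. *)
Definition extend k (a : cochain R X k) : cochain R Y k := fun t =>
  if pselect (exists s, push incl_continuous s = t) is left h
  then a (sval (cid h)) else 0.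

Lemma pull_extend k (a : cochain R X k) : pull incl_continuous (extend a) = a.
Proof.
apply/funext => s; rewrite /pull /extend; case: pselect => [h|]; last first.
  by case; exists s.
by congr a; apply: push_incl_inj; exact: (svalP (cid h)).
Qed.

Lemma sq_null d n k (z : cocycle R X k) :
  (forall s, s \in faces K -> #|s| <= d.+1)%N -> (0 < n)%N -> (d < n.*2)%N ->
  sq_cochain n (cocycle_val z) \in @is_coboundary R X (k + n).
Proof.
move=> Kd n0 dn; case: z => a /= /eqP da.
rewrite -(pull_extend a) sq_pull; set b := extend a.
have db : vanish inside (coboundary b).
  move=> t /inside_push[s <-].
  by rewrite -[LHS]/(pull incl_continuous _ s) -coboundary_pull pull_extend da.
have dsq : vanish inside (coboundary (sq_cochain n b)).
  rewrite /sq_cochain; case: ifP => _; last by rewrite coboundary0.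
  rewrite coboundary_cup [cup (k - n) b b + _]cochain_addxx addr0.
  have hI := hereditary_inside.
  by apply: vanishD; [exact: vanish_cupl | exact: vanish_cupr].
(* With [P] empty, [right_some] holds of nothing, so relative exactness here is absolute
   exactness. *)
have : rel_exact start (right_some finset.set0) (sq_cochain n b).
  apply: (sq_vanishes_all n0) => [P||].
  - by apply: (sq_vanishes_base (faces0 K) Kd).
  - by apply: sub_vanish db; exact: start_inside.
  - by move=> s [_ [i]]; rewrite inE.
move: (sq_cochain n b) dsq; have : (0 < k + n)%N by lia.
case: (k + n)%N => // l _ c dc ec; apply/asboolP.
have [|v cv] := @start_exact l c dc.
  apply: (exact_sub _ _ ec) => // A _ [].
exists (pull incl_continuous v); rewrite coboundary_pull.
apply/funext => s; have := cv _ (@im_push_inside _ s).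
rewrite -[LHS]/(_ + _) -[pull _ c s]/(c _) -[pull _ (coboundary v) s]/(coboundary v _).
by move: (c _) (coboundary v _); f2.
Qed.

Lemma Sq_eq0 d n k (x : cohomology R X k) :
  (forall s, s \in faces K -> #|s| <= d.+1)%N -> (0 < n)%N -> (d < n.*2)%N ->
  Sq n x = 0.
Proof.
move=> Kd n0 dn; rewrite -[x]reprK SqE.
rewrite -(raddf0 (\pi_(cohomology R X (k + n)))%qT); apply/eqP.
rewrite -Quotient.idealrBE subr0; exact: (sq_null (repr x) Kd n0 dn).
Qed.

End MomentAngleCohomology.

Theorem corollary4p3p1 (R : realType) (m : nat) (K : simplicial_complex m) :
  (forall d : int, complex_dim K = d ->
     forall n : nat, (0 < n)%N -> (d %/ 2)%Z < n%:Z ->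
     forall (k : nat) (a : cohomology R (moment_angle R K) k), Sq n a = 0)
  /\
  (complex_dim K = 1 ->
     forall n : nat, (0 < n)%N ->
     forall (k : nat) (a : cohomology R (moment_angle R K) k), Sq n a = 0).
Proof.
have main (d : int) : complex_dim K = d ->
    forall n : nat, (0 < n)%N -> (d %/ 2)%Z < n%:Z ->
    forall (k : nat) (a : cohomology R (moment_angle R K) k), Sq n a = 0.
  move=> Kd n n0 dn k a.
  pose c := (\max_(s in faces K) #|s|)%N.
  (* [c.-1] is the dimension when c > 0. For dimension -1 the truncated predecessor gives 0, and the
     bounds then follow from n > 0. *)
  apply: (@Sq_eq0 _ _ _ c.-1) => //.
    move=> s sK; apply: leq_trans _ (leqSpred _).
    rewrite /c; exact: (@leq_bigmax_cond _ (mem (faces K)) (fun s : {set 'I_m} => #|s|)).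
  move: Kd; rewrite /complex_dim -/c; case: c => [|c] e; first by lia.
  lia.
by split=> // K1 n n0; apply: (main 1).
Qed.
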